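(* Let $p$ be a prime. For each $\lambda\in[0,1]$ there exists a subgroup $G\subseteq\Gamma(p)$ generated by $3$ elements such that the closure of $G$ in $\Gamma(p)$ has Hausdorff dimension $\lambda$.
   Context: Let $T$ be the infinite rooted $p$-ary tree whose vertices are the finite sequences over $X=\{0,\dots,p-1\}$ (level $n$ = sequences of length $n$). Let $C_p$ be the cyclic group generated by $x\mapsto x+1 \pmod p$ on $X$. $\Gamma=\Gamma(p)$ is the profinite group of all tree automorphisms given by maps $g:V(T)\to C_p$, acting by $(x_1,\dots,x_\ell)^g=(x_1^{g(())},x_2^{g((x_1))},\dots,x_\ell^{g((x_1,\dots,x_{\ell-1}))})$. $\Gamma^{(n)}$ is the pointwise stabilizer of level $n$, and $\Gamma_n=\Gamma/\Gamma^{(n)}$, of order $p^{(p^n-1)/(p-1)}$. Metric on $\Gamma$: $\mathrm{dist}(g,h)=|\Gamma_n|^{-1}$, where $n$ is the greatest integer with $gh^{-1}\in\Gamma^{(n)}$ (and $\mathrm{dist}(g,g)=0$). Hausdorff dimension is taken with respect to this metric. For a closed subgroup $G$ it equals $\liminf_{n\to\infty}\log|G\Gamma^{(n)}/\Gamma^{(n)}|/\log|\Gamma_n|$. *)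

(* Defs.v *)
From HB Require Import structures.
From mathcomp Require Import all_boot all_order all_algebra.
From mathcomp Require Import finmap.
From mathcomp Require Import all_classical all_reals all_analysis.

Set Implicit Arguments.
Unset Strict Implicit.
Unset Printing Implicit Defensive.
Import Order.TTheory GRing.Theory Num.Theory.

Local Open Scope classical_set_scope.
Local Open Scope ring_scope.

Section HausdorffDimension.
Context {R : realType} {T : metricType R}.
Local Open Scope ereal_scope.

(* Equals -oo when U = set0. *)
Definition diam (U : set T) : \bar R :=
  ereal_sup [set z | exists x y : T, [/\ U x, U y & z = (mdist x y)%:E]].

(* The empty set weighs 0 also when s = 0, where poweR would give 1. *)
Definition hausdorff_weight (s : R) (U : set T) : \bar R :=
  if U == set0 then 0 else poweR (diam U) s.

Definition hausdorff_pre (s delta : R) (E : set T) : \bar R :=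
  ereal_inf [set \sum_(0 <= i <oo) hausdorff_weight s (U i) | U in
    [set U : nat -> set T | E `<=` \bigcup_i U i /\
                            forall i, diam (U i) <= delta%:E]].

Definition hausdorff_measure (s : R) (E : set T) : \bar R :=
  ereal_sup [set hausdorff_pre s delta E | delta in [set d : R | (0 < d)%R]].

Definition hausdorff_dim (E : set T) : \bar R :=
  ereal_inf [set s%:E | s in
    [set s : R | (0 <= s)%R /\ hausdorff_measure s E = 0]].

End HausdorffDimension.

Definition subgroup_set (G : groupType) (H : set G) : Prop :=
  H 1%g /\ forall x y, H x -> H y -> H (x * y^-1)%g.

Definition generated (G : groupType) (S : set G) : set G :=
  smallest (@subgroup_set G) S.

(* A vertex is a word over X = 'Z_p, and a label c : 'Z_p stands for the
   element x |-> x + c of C_p. Note that 'Z_p is the ring of integers mod p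
   only for 1 < p. *)
Record Gamma (p : nat) := MkGamma { label :> seq 'Z_p -> 'Z_p }.

HB.instance Definition _ p := gen_eqMixin (Gamma p).
HB.instance Definition _ p := gen_choiceMixin (Gamma p).

Definition act p (g : Gamma p) (v : seq 'Z_p) : seq 'Z_p :=
  mkseq (fun i => v`_i + g (take i v)) (size v).

Section GroupStructure.
Variable p : nat.
Implicit Types (g h : Gamma p) (v : seq 'Z_p).

Lemma size_act g v : size (act g v) = size v.
Proof. exact: size_mkseq. Qed.

Lemma take_act g v i : take i (act g v) = act g (take i v).
Proof.
apply: (@eq_from_nth _ 0) => [|j]; first by rewrite size_act !size_take size_act.
rewrite size_take_min size_act leq_min => /andP[lti ltv].
rewrite nth_take// !nth_mkseq ?size_take_min ?leq_min ?lti//.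
by rewrite nth_take// take_takel// ltnW.
Qed.

Lemma act_rcons g v x : act g (rcons v x) = rcons (act g v) (x + g v).
Proof.
rewrite /act size_rcons /mkseq -[(size v).+1]addn1 iotaD map_cat/= cats1 add0n.
rewrite nth_rcons ltnn eqxx -(cats1 v x) take_size_cat//; congr rcons.
apply/eq_in_map => i; rewrite mem_iota add0n => /= iv.
by rewrite nth_cat iv takel_cat// ltnW.
Qed.

Lemma act_faithful g h : act g =1 act h -> g = h.
Proof.
case: g h => [g] [h] gh; congr MkGamma; apply/funext => v.
have /(congr1 (last 0)) := gh (rcons v 0).
by rewrite !act_rcons !last_rcons !add0r.
Qed.

Definition Gamma_one : Gamma p := MkGamma (fun=> 0).

(* Automorphisms act on the right: v^(g * h) = (v^g)^h. *)
Definition Gamma_mul g h : Gamma p := MkGamma (fun v => g v + h (act g v)).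

Definition unact g v : seq 'Z_p :=
  foldl (fun u x => rcons u (x - g u)) [::] v.

Definition Gamma_inv g : Gamma p := MkGamma (fun v => - g (unact g v)).

Lemma act1 v : act Gamma_one v = v.
Proof.
apply: (@eq_from_nth _ 0) => [|i]; rewrite size_act// => iv.
by rewrite nth_mkseq// addr0.
Qed.

Lemma actM g h v : act (Gamma_mul g h) v = act h (act g v).
Proof.
apply: (@eq_from_nth _ 0) => [|i]; rewrite !size_act// => iv.
by rewrite !nth_mkseq ?size_act//= take_act addrA.
Qed.

Lemma unactK g : cancel (unact g) (act g).
Proof.
elim/last_ind => [//|v x IH].
by rewrite /unact foldl_rcons -/(unact g v) act_rcons IH subrK.
Qed.

Lemma act_inv g v : act (Gamma_inv g) v = unact g v.
Proof.
elim/last_ind: v => [//|v x IH].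
by rewrite act_rcons IH /unact foldl_rcons.
Qed.

Lemma Gamma_mulA : associative Gamma_mul.
Proof. by move=> g h k; apply: act_faithful => v; rewrite !actM. Qed.

Lemma Gamma_mul1 : left_id Gamma_one Gamma_mul.
Proof. by move=> g; apply: act_faithful => v; rewrite !actM act1. Qed.

Lemma Gamma_mulr1 : right_id Gamma_one Gamma_mul.
Proof. by move=> g; apply: act_faithful => v; rewrite !actM act1. Qed.

Lemma Gamma_mulV : left_inverse Gamma_one Gamma_inv Gamma_mul.
Proof.
by move=> g; apply: act_faithful => v; rewrite actM act_inv unactK act1.
Qed.

Lemma Gamma_mulrV : right_inverse Gamma_one Gamma_inv Gamma_mul.
Proof.
move=> g; have VV : Gamma_inv (Gamma_inv g) = g.
  rewrite -[LHS]Gamma_mulr1 -(Gamma_mulV g) Gamma_mulA Gamma_mulV.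
  exact: Gamma_mul1.
by rewrite -[X in Gamma_mul X _]VV Gamma_mulV.
Qed.

End GroupStructure.

HB.instance Definition _ p := isGroup.Build (Gamma p) (@Gamma_mulA p)
  (@Gamma_mul1 p) (@Gamma_mulr1 p) (@Gamma_mulV p) (@Gamma_mulrV p).

Definition level_stab p (n : nat) : set (Gamma p) :=
  [set g | forall v, size v = n -> act g v = v].

(* The order of Gamma / Gamma^(n), as the number of cosets of Gamma^(n). *)
Definition Gamma_order p (n : nat) : nat :=
  #|` fset_set (range (fun g : Gamma p =>
        [set h : Gamma p | level_stab n (g * h^-1)%g])) |.

(* The greatest n with g in Gamma^(n); it exists exactly when g != 1. *)
Definition depth p (g : Gamma p) : nat :=
  xget 0%N [set n | level_stab n g /\
                    forall m, level_stab m g -> (m <= n)%N].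

Definition Gamma_dist (R : realType) p (g h : Gamma p) : R :=
  if g == h then 0 else (Gamma_order p (depth (g * h^-1)%g))%:R^-1.

Section LevelStabilizers.
Variable p : nat.
Implicit Types (g h k : Gamma p) (v : seq 'Z_p).

Lemma act_level_eq n g h :
  (forall v, size v = n -> act g v = act h v) <->
  (forall v, (size v < n)%N -> g v = h v).
Proof.
split=> [gh v vn|gh v vn]; last first.
  apply: (@eq_from_nth _ 0) => [|i]; rewrite !size_act// => iv.
  by rewrite !nth_mkseq// gh// size_takel ?(ltnW iv)// -vn.
pose w := rcons v 0 ++ nseq (n - (size v).+1) 0.
have /(congr1 (take (size v).+1)) : act g w = act h w.
  by apply: gh; rewrite /w size_cat size_rcons size_nseq subnKC.
rewrite !take_act /w take_size_cat ?size_rcons// !act_rcons.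
by move=> /(congr1 (last 0)); rewrite !last_rcons !add0r.
Qed.

Lemma level_stab_div n g h :
  level_stab n (g * h^-1)%g <-> (forall v, (size v < n)%N -> g v = h v).
Proof.
rewrite -act_level_eq; split=> gh v vn.
  have := gh v vn; rewrite actM => /(congr1 (act h)).
  by rewrite [act (h^-1)%g _]act_inv unactK.
rewrite actM gh// -actM; have -> : Gamma_mul h (h^-1)%g = 1%g by exact: mulgV.
exact: act1.
Qed.

Lemma level_stab_div_le m n g h : (m <= n)%N ->
  level_stab n (g * h^-1)%g -> level_stab m (g * h^-1)%g.
Proof.
by move=> mn /level_stab_div gh; apply/level_stab_div => v vm;
  apply: gh; exact: leq_trans mn.
Qed.

Lemma depth_div m g h : g != h ->
  level_stab m (g * h^-1)%g <-> (m <= depth (g * h^-1)%g)%N.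
Proof.
move=> gh; have [v ghv] : exists v, g v != h v.
  apply: contra_notP (elimN eqP gh) => /forallNP ghN.
  case: g h ghN {gh} => [g] [h] /= ghN; congr MkGamma; apply/funext => v.
  by have /negP/negPn/eqP := ghN v.
have bnd n : level_stab n (g * h^-1)%g -> (n <= size v)%N.
  move=> /level_stab_div ghn; rewrite leqNgt; apply/negP => /ghn/eqP.
  exact/negP.
pose P := [pred n | `[< level_stab n (g * h^-1)%g >] ].
have exP : exists n, P n by exists 0%N; apply/asboolP/level_stab_div.
have ubP n : P n -> (n <= size v)%N by move=> /asboolP/bnd.
have : exists d, level_stab d (g * h^-1)%g /\
    forall m, level_stab m (g * h^-1)%g -> (m <= d)%N.
  case: (ex_maxnP exP ubP) => d /asboolP Pd maxd; exists d; split=> // k Pk.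
  by apply: maxd; apply/asboolP.
move=> /(@xgetPex _ 0%N) [Pd maxd]; split; first exact: maxd.
by move=> md; apply: level_stab_div_le md Pd.
Qed.

Lemma card_Gamma_order n :
  Gamma_order p n = (#|'Z_p| ^ (\sum_(i < n) #|'Z_p| ^ i))%N.
Proof.
pose W := {i : 'I_n & i.-tuple 'Z_p}.
pose coset g : set (Gamma p) := [set h | level_stab n (g * h^-1)%g].
pose ext (f : {ffun W -> 'Z_p}) : Gamma p := MkGamma (fun v =>
  if [pick w : W | tval (tagged w) == v] is Some w then f w else 0).
have extE f (w : W) : ext f (tagged w) = f w.
  rewrite /=; case: pickP => [w' /eqP|/(_ w)]; last by rewrite eqxx.
  case: w w' => [i t] [j u] /= ut.
  have ji : j = i by apply: val_inj; rewrite /= -(size_tuple u) ut size_tuple.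
  by subst j; congr (f _); congr existT; apply: val_inj.
have coset_eq g h : (coset g = coset h) <->
    (forall v, (size v < n)%N -> g v = h v).
  split=> [gh|gh].
    have : coset h h by apply/level_stab_div.
    by rewrite -gh => /level_stab_div.
  apply/seteqP; split=> k /level_stab_div gk; apply/level_stab_div => v vn.
    by rewrite -gh// gk.
  by rewrite gh// gk.
have F_inj : injective (coset \o ext).
  move=> f f' /= /coset_eq ff'; apply/ffunP => w.
  by rewrite -!extE ff'// size_tuple.
have rangeF : range coset = range (coset \o ext).
  apply/seteqP; split=> _ [g _ <-]; last by exists (ext g).
  exists [ffun w : W => g (tagged w)] => //=; apply/coset_eq => v vn.
  have := extE [ffun w : W => g (tagged w)]
    (Tagged (fun i : 'I_n => i.-tuple 'Z_p) (in_tuple v : (Ordinal vn).-tuple 'Z_p)).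
  by rewrite ffunE.
have finF : finite_set (range (coset \o ext)) 
  by apply: finite_image; exact: finite_finset.
rewrite /Gamma_order -/coset rangeF.
have -> : fset_set (range (coset \o ext)) =
    [fset (coset \o ext) x | x in {: {ffun W -> 'Z_p}}]%fset.
  apply/fsetP => A; rewrite in_fset_set//; apply/idP/imfsetP => /=.
    by rewrite inE => -[f _ <-]; exists f; rewrite ?inE.
  by move=> [f _ ->]; rewrite inE; exists f.
rewrite card_imfset//= -cardE card_ffun; congr (_ ^ _)%N.
rewrite card_tagged sumnE big_map big_enum/=.
by apply: eq_bigr => i _; rewrite card_tuple.
Qed.

Lemma card_Zp_gt1 : (1 < #|'Z_p|)%N.
Proof. by rewrite card_ord. Qed.

Lemma leq_Gamma_order m n :
  (Gamma_order p m <= Gamma_order p n)%N = (m <= n)%N.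
Proof.
rewrite !card_Gamma_order leq_exp2l ?card_Zp_gt1//.
have inc : {mono (fun n => \sum_(i < n) #|'Z_p| ^ i)%N : m n / (m <= n)%N}.
  apply: leq_mono => i j ij; rewrite -(subnKC ij) big_split_ord/= big_ord_recr/=.
  by rewrite -addnA -addn1 leq_add2l addn_gt0 expn_gt0 (ltnW card_Zp_gt1).
exact: inc.
Qed.

Lemma Gamma_order_gt n : (n < Gamma_order p n)%N.
Proof.
rewrite card_Gamma_order; apply: leq_trans (ltn_expl _ card_Zp_gt1) _.
rewrite leq_exp2l ?card_Zp_gt1// -[X in (X <= _)%N](card_ord n) -sum1_card.
by apply: leq_sum => i _; rewrite expn_gt0 (ltnW card_Zp_gt1).
Qed.

End LevelStabilizers.

Lemma prime_Gamma_order p n : prime p ->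
  Gamma_order p n = (p ^ ((p ^ n - 1) %/ (p - 1)))%N.
Proof.
move=> pp; rewrite card_Gamma_order card_ord Zp_cast ?prime_gt1//.
by rewrite !subn1 predn_exp mulKn// -subn1 subn_gt0 prime_gt1.
Qed.

Section GammaMetric.
Variable p : nat.
Implicit Types (g h k : Gamma p).
Local Open Scope relation_scope.

Definition Gamma_ent : set_system (Gamma p * Gamma p) :=
  filter_from setT
    (fun n => [set gh : Gamma p * Gamma p | level_stab n (gh.1 * gh.2^-1)%g]).

Lemma Gamma_ent_filter : Filter Gamma_ent.
Proof.
apply: filter_from_filter; first by exists 0%N.
move=> m n _ _; exists (maxn m n) => // -[g h] /= gh.
by split; apply: level_stab_div_le gh; rewrite ?leq_maxl ?leq_maxr.
Qed.

Lemma Gamma_ent_diagonal A : Gamma_ent A -> diagonal `<=` A.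
Proof.
move=> [n _ nA] [g h] gh; apply: nA; have -> : g = h by [].
by apply/level_stab_div.
Qed.

Lemma Gamma_ent_inv A : Gamma_ent A -> Gamma_ent A^-1.
Proof.
move=> [n _ nA]; exists n => // -[g h] /level_stab_div gh; apply: nA => /=.
by apply/level_stab_div => v vn; rewrite gh.
Qed.

Lemma Gamma_ent_split A :
  Gamma_ent A -> exists2 B, Gamma_ent B & B \; B `<=` A.
Proof.
move=> [n _ nA].
exists [set gh : Gamma p * Gamma p | level_stab n (gh.1 * gh.2^-1)%g].
  by exists n.
move=> [g h] [k] /= gk kh; apply: nA => /=.
move/level_stab_div: gk => gk; move/level_stab_div: kh => kh.
by apply/level_stab_div => v vn; rewrite gk// kh.
Qed.

HB.instance Definition _ := isUniform.Build (Gamma p)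
  Gamma_ent_filter Gamma_ent_diagonal Gamma_ent_inv Gamma_ent_split.

Local Close Scope relation_scope.
Context {R : realType}.
Local Notation dist := (@Gamma_dist R p).

Lemma Gamma_dist_ge0 g h : 0 <= dist g h.
Proof. by rewrite /Gamma_dist; case: ifP. Qed.

Lemma Gamma_dist_eq0 g h : dist g h = 0 -> g = h.
Proof.
rewrite /Gamma_dist; case: eqP => // _ /eqP.
by rewrite invr_eq0 pnatr_eq0 gtn_eqF// (leq_trans _ (Gamma_order_gt _ _)).
Qed.

Lemma Gamma_dist_le n g h :
  dist g h <= (Gamma_order p n)%:R^-1 <-> level_stab n (g * h^-1)%g.
Proof.
rewrite /Gamma_dist; have [->|gh] := eqVneq g h.
  by split=> // _; apply/level_stab_div.
rewrite depth_div// lef_pV2 ?posrE ?ltr0n ?(leq_ltn_trans _ (Gamma_order_gt _ _))//.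
by rewrite ler_nat leq_Gamma_order.
Qed.

Lemma Gamma_dist_sym g h : dist g h = dist h g.
Proof.
have le k l : dist k l <= dist l k.
  rewrite {2}/Gamma_dist; have [->|lk] := eqVneq l k.
    by rewrite /Gamma_dist eqxx.
  apply/Gamma_dist_le; have /(depth_div _) := lk => /(_ (depth (l * k^-1)%g))[_].
  move=> /(_ (leqnn _)) /level_stab_div lkd.
  by apply/level_stab_div => v vd; rewrite lkd.
by apply/eqP; rewrite eq_le !le.
Qed.

Lemma Gamma_dist_ultra h g k : dist g k <= Num.max (dist g h) (dist h k).
Proof.
have [<-|gh] := eqVneq g h; first by rewrite le_max lexx orbT.
have [<-|hk] := eqVneq h k; first by rewrite le_max lexx.
pose d := minn (depth (g * h^-1)%g) (depth (h * k^-1)%g).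
have /Gamma_dist_le : level_stab d (g * k^-1)%g.
  have /level_stab_div ghd : level_stab d (g * h^-1)%g.
    by apply/depth_div => //; exact: geq_minl.
  have /level_stab_div hkd : level_stab d (h * k^-1)%g.
    by apply/depth_div => //; exact: geq_minr.
  by apply/level_stab_div => v vd; rewrite ghd// hkd.
move=> /le_trans; apply; rewrite le_max /Gamma_dist (negbTE gh) (negbTE hk).
by rewrite /d /minn; case: ifP => _; rewrite lexx ?orbT.
Qed.

Definition Gamma_ball g (e : R) : set (Gamma p) := [set h | dist g h < e].

Lemma Gamma_ball_center g (e : R) : 0 < e -> Gamma_ball g e g.
Proof. by rewrite /Gamma_ball /= /Gamma_dist eqxx. Qed.

Lemma Gamma_ball_sym g h (e : R) : Gamma_ball g e h -> Gamma_ball h e g.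
Proof. by rewrite /Gamma_ball /= Gamma_dist_sym. Qed.

Lemma Gamma_ball_triangle g h k (e1 e2 : R) :
  Gamma_ball g e1 h -> Gamma_ball h e2 k -> Gamma_ball g (e1 + e2) k.
Proof.
rewrite /Gamma_ball /= => ghe hke; apply: le_lt_trans (Gamma_dist_ultra h g k) _.
have e1_gt0 := le_lt_trans (Gamma_dist_ge0 _ _) ghe.
have e2_gt0 := le_lt_trans (Gamma_dist_ge0 _ _) hke.
by rewrite gt_max (lt_trans ghe) ?(lt_trans hke) ?ltrDl ?ltrDr.
Qed.

Lemma Gamma_entourageE : entourage = entourage_ Gamma_ball.
Proof.
have order_gt0 n : 0 < (Gamma_order p n)%:R :> R.
  by rewrite ltr0n (leq_ltn_trans _ (Gamma_order_gt _ _)).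
apply/funext => A; apply/propext; split=> [[n _ nA]|[e /= e0 eA]].
  exists (Gamma_order p n)%:R^-1; first by rewrite /= invr_gt0.
  by move=> [g h] /= /ltW/Gamma_dist_le gh; exact: nA.
pose n := Num.truncn e^-1; exists n => // -[g h] /= /Gamma_dist_le gh; apply: eA.
rewrite /Gamma_ball /=; apply: le_lt_trans gh _.
rewrite invf_plt ?posrE//; apply: lt_le_trans (truncnS_gt _) _.
by rewrite ler_nat Gamma_order_gt.
Qed.

HB.instance Definition _ := Uniform_isPseudoMetric.Build R (Gamma p)
  Gamma_ball_center Gamma_ball_sym Gamma_ball_triangle Gamma_entourageE.

Lemma Gamma_ballE g (e : R) : ball g e = [set h | dist g h < e].
Proof. by []. Qed.

HB.instance Definition _ := PseudoMetric_isMetric.Build R (Gamma p)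
  Gamma_dist_ge0 Gamma_dist_eq0 Gamma_ballE.

End GammaMetric.

(* Main.v *)
Require Import Defs.
From mathcomp Require Import all_boot all_order all_algebra.
From mathcomp Require Import all_classical all_reals all_analysis.
From mathcomp Require Import zify lra.

(** Let Omega be the set of words whose interval (as p-adic expansions of reals) is
contained in [0, lambda]: it is closed under extension and has lambda p^n + O(1) words of
length n, so any group of automorphisms supported on Omega has dimension at
most lambda, and it suffices to produce a 3-generated one which fills almost
all of the labels on Omega.

Below each minimal word of Omega the first generator (shifter) acts as the
odometer.  The second (mover) acts as the odometer below sparse "seats", and
the third (marker) c has label 1 exactly on sparse "spots", one of length n
below any given minimal word for almost all n.  For a conjugate y of a power
of the mover by a power of the shifter, chosen so that a seat is carried onto
a spot u of length n, y fixes the trees below all other spots of length at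
most n.  Hence c^y c^-1 stabilizes level n and has labels
[v = u^y] - [v = u] there.  Conjugating by the shifter, all but o(p^n) of
the labels on Omega of level n can be prescribed freely.

For the lower bound on the dimension, a cover by cosets of total weight less
than 1, where a coset of depth n weighs the inverse of the number of
prescribed labellings above level n, is avoided by a greedy choice of labels
level by level; the limit is a point of the closure that is not covered. *)

Set Implicit Arguments.
Unset Strict Implicit.
Unset Printing Implicit Defensive.
Import Order.TTheory GRing.Theory Num.Theory.

Local Open Scope classical_set_scope.
Local Open Scope ring_scope.

(** * Words, the odometer and grafted odometers *)

Section Construction.
Variable p : nat.
Local Notation P := (Zp_trunc p).+2.
Local Notation word := (seq 'Z_p).
Implicit Types (g h k : Gamma p) (u v w r s : word).

(** Little-endian: the first letter is the least significant digit, so the prefix of length [l]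
    gives the residue modulo [P ^ l]. *)
Definition code u : nat := foldr (fun (x : 'Z_p) n => (x + P * n)%N) 0%N u.

Lemma code_cat u v : code (u ++ v) = (code u + P ^ size u * code v)%N.
Proof.
elim: u => [|x u IH] /=; first by rewrite expn0 mul1n.
by rewrite IH expnS mulnDr addnA mulnA.
Qed.

Lemma code_rcons u (x : 'Z_p) : code (rcons u x) = (code u + P ^ size u * x)%N.
Proof. by rewrite -cats1 code_cat /= muln0 addn0. Qed.

Lemma ltn_code u : (code u < P ^ size u)%N.
Proof.
elim: u => [|x u IH] //=; rewrite expnS.
apply: (@leq_trans (P * (code u).+1)%N); last by rewrite leq_mul2l IH orbT.
by rewrite mulnS ltn_add2r; exact: (ltn_ord x).
Qed.

Lemma code_inj u v : size u = size v -> code u = code v -> u = v.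
Proof.
elim: u v => [|x u IH] [|y v] //= [suv] e.
have xy : x = y :> nat.
  have := congr1 (modn^~ P) e.
  by rewrite /= !(mulnC P) !(addnC (nat_of_ord _)) !modnMDl !modn_small.
rewrite (IH v suv); last by move/eqP: e; rewrite xy eqn_add2l eqn_mul2l /= => /eqP.
by congr (_ :: _); apply: val_inj.
Qed.

Lemma code_nseq0 n : code (nseq n 0) = 0%N.
Proof. by elim: n => //= n ->; rewrite muln0. Qed.

Lemma code_eq0 u : code u = 0%N -> u = nseq (size u) 0.
Proof. by move=> u0; apply: code_inj; rewrite ?size_nseq// code_nseq0. Qed.

Lemma actMg g h u : act (g * h)%g u = act h (act g u).
Proof. exact: actM. Qed.

Lemma act1g u : act (1%g : Gamma p) u = u.
Proof. exact: act1. Qed.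

Lemma actK g : cancel (act g) (act g^-1%g).
Proof. by move=> u; rewrite -actMg mulgV act1g. Qed.

Lemma actVK g : cancel (act g^-1%g) (act g).
Proof. by move=> u; rewrite -actMg mulVg act1g. Qed.

Lemma labelM g h u : (g * h)%g u = g u + h (act g u).
Proof. by []. Qed.

Lemma labelV g u : (g^-1)%g u = - g (act g^-1%g u).
Proof. by rewrite act_inv. Qed.

Lemma label_fix g u : (forall x, act g (rcons u x) = rcons u x) -> g u = 0.
Proof.
move=> /(_ 0)/(congr1 (last 0)); rewrite act_rcons !last_rcons.
by rewrite add0r.
Qed.

(** The adding machine: the label is the carry, which arises when all letters so far are maximal, in
    particular at the empty word. *)
Definition odometer : Gamma p :=
  MkGamma (fun u => if (code u).+1 == (P ^ size u)%N then 1 else 0).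

Lemma code_odometer u : code (act odometer u) = ((code u).+1 %% P ^ size u)%N.
Proof.
elim/last_ind: u => [//|u x IH].
rewrite act_rcons code_rcons size_act IH code_rcons size_rcons expnSr.
have -> : odometer u = if (code u).+1 == (P ^ size u)%N then 1 else 0 by [].
case: eqP => [e|/eqP ne].
  rewrite -addSn e modnn add0n -mulnS -muln_modr; congr (_ * _)%N.
  by rewrite /= modnDmr addn1.
rewrite addr0 modn_small ?modn_small//; last by rewrite ltn_neqAle ne ltn_code.
rewrite -addSn mulnC -ltnS.
have := ltn_ord x; have := ltn_code u; nia.
Qed.

Lemma code_odometerX t u :
  code (act (odometer ^+ t)%g u) = ((code u + t) %% P ^ size u)%N.
Proof.
elim: t => [|t IH]; first by rewrite expg0 act1g addn0 modn_small// ltn_code.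
by rewrite expgSr actMg code_odometer IH size_act -addn1 modnDml addn1 addnS.
Qed.

Lemma exists_code n t : (t < P ^ n)%N -> exists2 u, size u = n & code u = t.
Proof.
move=> tn; exists (act (odometer ^+ t)%g (nseq n 0)).
  by rewrite size_act size_nseq.
by rewrite code_odometerX code_nseq0 size_nseq add0n modn_small.
Qed.

(** Odometers hang at the words of [A] without proper prefix in [A]. If no prefix of [u] lies in
    [A], [find] returns [(size u).+1], which the test catches. *)
Definition graft (A : pred word) : Gamma p :=
  MkGamma (fun u =>
    let i := find (fun i => A (take i u)) (iota 0 (size u).+1) in
    if (i <= size u)%N then odometer (drop i u) else 0).

Definition minimal (A : pred word) u :=
  A u /\ forall i, (i < size u)%N -> ~~ A (take i u).

Lemma graft_out A u :
  (forall i, (i <= size u)%N -> ~~ A (take i u)) -> graft A u = 0.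
Proof.
move=> Au; rewrite /graft /label hasNfind ?size_iota ?ltnn//.
by apply/hasPn => i; rewrite mem_iota add0n ltnS; exact: Au.
Qed.

Lemma graft_in A r s : minimal A r -> graft A (r ++ s) = odometer s.
Proof.
move=> [Ar Amin]; rewrite /graft /label.
suff -> : find (fun i => A (take i (r ++ s))) (iota 0 (size (r ++ s)).+1) = size r.
  by rewrite size_cat leq_addr drop_size_cat.
have sz : (size r < size (iota 0 (size (r ++ s)).+1))%N.
  by rewrite size_iota ltnS size_cat leq_addr.
apply/eqP; rewrite eqn_leq; apply/andP; split; last first.
  rewrite leqNgt; apply/negP => lt.
  have h : has (fun i => A (take i (r ++ s))) (iota 0 (size (r ++ s)).+1).
    by rewrite has_find (ltn_trans lt).
  have := nth_find 0%N h; rewrite nth_iota ?add0n; last first.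
    by move: h; rewrite has_find size_iota.
  by rewrite takel_cat ?(ltnW lt)//; apply/negP/Amin.
rewrite leqNgt; apply/negP => /(before_find 0%N).
rewrite nth_iota ?add0n ?take_size_cat ?Ar//.
by rewrite size_iota in sz.
Qed.

(** Only labels at proper prefixes move [u], so [u] itself may lie in [A]. *)
Lemma act_graft_out A u :
  (forall i, (i < size u)%N -> ~~ A (take i u)) -> act (graft A) u = u.
Proof.
elim/last_ind: u => [//|u x IH] Au; rewrite act_rcons.
have tk i : (i <= size u)%N -> take i (rcons u x) = take i u.
  by move=> iu; rewrite -cats1 takel_cat.
rewrite IH ?graft_out ?addr0// => i iu; rewrite -tk ?(ltnW iu)//;
  apply: Au; rewrite size_rcons ltnS//; exact: ltnW.
Qed.

Lemma act_graft_in A r s : minimal A r -> act (graft A) (r ++ s) = r ++ act odometer s.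
Proof.
move=> Ar; elim/last_ind: s => [|s x IH].
  by rewrite cats0 act_graft_out ?cats0//; case: Ar.
by rewrite -rcons_cat !act_rcons IH graft_in// rcons_cat.
Qed.

Lemma act_graft_inX A r s t :
  minimal A r -> act (graft A ^+ t)%g (r ++ s) = r ++ act (odometer ^+ t)%g s.
Proof.
move=> Ar; elim: t => [|t IH]; first by rewrite !expg0 !act1g.
by rewrite !expgSr !actMg IH act_graft_in.
Qed.

(** Minimal words form an antichain, and two prefixes of one word are comparable. *)
Lemma minimal_uniq A r r' u : minimal A r -> minimal A r' ->
  take (size r) u = r -> take (size r') u = r' -> r = r'.
Proof.
move=> [Ar mr] [Ar' mr'] er er'; case: (ltngtP (size r) (size r')) => sz.
- by have := mr' _ sz; rewrite -er' take_takel ?(ltnW sz)// er Ar.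
- by have := mr _ sz; rewrite -er take_takel ?(ltnW sz)// er' Ar'.
- by rewrite -er -er' sz.
Qed.

End Construction.

Section Subgroups.
Variables (p : nat) (H : set (Gamma p)).
Hypothesis subH : subgroup_set H.
Implicit Types g h : Gamma p.

Lemma subgroupV g : H g -> H g^-1%g.
Proof. by move=> Hg; rewrite -[(g^-1)%g]mul1g; apply: (subH.2); first exact: subH.1. Qed.

Lemma subgroupM g h : H g -> H h -> H (g * h)%g.
Proof. by move=> Hg Hh; rewrite -[h]invgK; apply: (subH.2) => //; exact: subgroupV. Qed.

Lemma subgroupX g m : H g -> H (g ^+ m)%g.
Proof.
by move=> Hg; elim: m => [|m IH]; rewrite ?expgS; [exact: subH.1|exact: subgroupM].
Qed.

End Subgroups.

(** * The three generators *)

Section ExactPower.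
Variables (P : nat) (P_gt1 : (1 < P)%N).
Local Open Scope nat_scope.

(** [P] may be composite, so the valuation is stated by two divisibilities rather than through
    [logn]. *)
Definition exact_power e N := (P ^ e %| N) && ~~ (P ^ e.+1 %| N).

Lemma exact_power_uniq e e' N : exact_power e N -> exact_power e' N -> e = e'.
Proof.
move=> /andP[d nd] /andP[d' nd']; case: (ltngtP e e') => // lt.
- by rewrite (dvdn_trans (dvdn_exp2l P lt) d') in nd.
- by rewrite (dvdn_trans (dvdn_exp2l P lt) d) in nd'.
Qed.

Lemma eqn_mod_expW N M l l' :
  l' <= l -> N = M %[mod P ^ l] -> N = M %[mod P ^ l'].
Proof.
move=> le e; have := congr1 (modn^~ (P ^ l')) e.
by rewrite /= !modn_dvdm// dvdn_exp2l.
Qed.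

Lemma exact_power_mod e l N M : e < l -> N = M %[mod P ^ l] ->
  exact_power e N = exact_power e M.
Proof.
move=> el NM; have dv d : d <= l -> (P ^ d %| N) = (P ^ d %| M).
  by move=> dl; rewrite /dvdn (eqn_mod_expW dl NM).
by rewrite /exact_power !dv// ltnW.
Qed.

Lemma exact_power_expM e m : ~~ (P %| m) -> exact_power e (P ^ e * m).
Proof.
move=> Pm; rewrite /exact_power dvdn_mulr// expnSr dvdn_pmul2l//.
by rewrite expn_gt0 (ltnW P_gt1).
Qed.

Lemma exact_power_exp e m : exact_power e (P ^ e * (1 + P * m)).
Proof.
by apply: exact_power_expM; rewrite dvdn_addl ?dvdn_mulr// gtnNdvd.
Qed.

Lemma expn_multiple e f : e <= f -> exists c, P ^ f = c * P ^ e.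
Proof. by move=> ef; apply/dvdnP; rewrite dvdn_exp2l. Qed.

(* Seats have even valuation 2j and spots odd valuation 2k+1; translating a
   seat by the difference between the k-th spot and the k-th seat gives a spot
   for j = k and otherwise keeps its valuation even, namely 2 min(j, k). *)
Lemma spots_separated k n k2 n2 j Q : n < P ^ k -> n2 < P ^ k2 ->
  Q = P ^ (2 * k2 + 1) * (1 + P * n2) %[mod P ^ (3 * k2 + 2)] ->
  Q + P ^ (2 * k) = P ^ (2 * j) + P ^ (2 * k + 1) * (1 + P * n)
    %[mod P ^ (3 * j + 2)] ->
  [/\ j = k, k2 = k & n2 = n].
Proof.
have odd_even a b : 2 * a + 1 <> 2 * b by lia.
have odd_inj a b : 2 * a + 1 = 2 * b + 1 -> a = b by lia.
have lt3 a : 2 * a + 1 < 3 * a + 2 by lia.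
have le3 a b : a <= b -> 2 * a + 1 <= 3 * b + 2 by lia.
have lt2 a b : a < b -> 2 * a + 1 <= 2 * b by lia.
have lt1 a b : a < b -> 2 * a + 1 <= 2 * b + 1 by lia.
move=> nk nk2 Q2 Qj.
have exQ : exact_power (2 * k2 + 1) Q.
  by rewrite (exact_power_mod (lt3 _) Q2) exact_power_exp.
case: (ltngtP j k) => jk.
(* For [j < k] both terms with exponents in [k] vanish modulo [P ^ (2 * j + 1)], which gives [Q] the
   even valuation [2 * j]. *)
- have Q2j : Q = P ^ (2 * j) %[mod P ^ (2 * j + 1)].
    move: (eqn_mod_expW (le3 _ _ (leqnn j)) Qj).
    have [c1 ->] := expn_multiple (lt2 _ _ jk).
    have [c2 ->] := expn_multiple (lt1 _ _ jk).
    by rewrite mulnAC ![(_ + _ * P ^ _)%N]addnC !modnMDl.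
  case: (odd_even k2 j); apply: exact_power_uniq exQ _.
  rewrite (exact_power_mod _ Q2j) ?addn1//.
  by have := exact_power_exp (2 * j) 0; rewrite muln0 muln1.
(* For [k < j], [Q] turns out to be [P ^ (2 * k)] times some [q] with [P] dividing [q.+1], so its
   valuation is again even. *)
- case: (odd_even k2 k); apply: exact_power_uniq exQ _.
  move: (eqn_mod_expW (le3 _ _ (ltnW jk)) Qj).
  have [c1 ->] := expn_multiple (lt2 _ _ jk).
  rewrite modnMDl modnMr => /eqP dQ.
  have dQ2 : P ^ (2 * k) %| Q.
    rewrite -(@dvdn_addl (P ^ (2 * k)))//.
    by apply: dvdn_trans dQ; rewrite dvdn_exp2l// addn1.
  case/dvdnP: dQ2 dQ => q ->; rewrite -mulSnr (mulnC q.+1) (mulnC q) addn1 expnSr.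
  rewrite -/(dvdn _ _) dvdn_pmul2l ?expn_gt0 ?(ltnW P_gt1)// => dq.
  apply: exact_power_expM; apply/negP => dq'.
  by move: dq; rewrite -addn1 dvdn_addr// gtnNdvd.
- subst j.
  have Qk : Q = P ^ (2 * k + 1) * (1 + P * n) %[mod P ^ (3 * k + 2)].
    by apply/eqP; rewrite -(eqn_modDr (P ^ (2 * k))) [X in _ == X %[mod _]]addnC;
      apply/eqP.
  have k2k : k2 = k.
    apply: odd_inj; apply: exact_power_uniq exQ _.
    by rewrite (exact_power_mod (lt3 _) Qk) exact_power_exp.
  subst k2; split=> //; move: Q2; rewrite Qk.
  (* After division by [P ^ (2 * k + 1)] the modulus keeps [k.+1] digits, just enough for
     [1 + P * n] with [n < P ^ k]. *)
  have -> : 3 * k + 2 = (2 * k + 1) + k.+1 by clear; lia.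
  rewrite (expnD P (2 * k + 1)) -!muln_modr => /eqP; rewrite eqn_mul2l expn_eq0.
  rewrite gtn_eqF ?(ltnW P_gt1)//= => /eqP.
  have b m : m < P ^ k -> 1 + P * m < P ^ k.+1.
    move=> mk; rewrite expnS; apply: (@leq_trans (P * m.+1)).
      by rewrite mulnS ltn_add2r.
    by rewrite leq_mul2l mk orbT.
  rewrite !modn_small ?b// => /eqP; rewrite eqn_add2l eqn_mul2l.
  by rewrite gtn_eqF ?(ltnW P_gt1)//= => /eqP.
Qed.

End ExactPower.

Section Generators.
Variable p : nat.
Local Notation P := (Zp_trunc p).+2.
Local Notation word := (seq 'Z_p).
Implicit Types (g h : Gamma p) (u v w r s : word).
Variable Omega : pred word.

(* Every word owns an arithmetic progression of indices, so it owns one with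
   P^k > n and k = O(log n). *)
Definition owner k v := logn 2 k == pickle v.

Lemma owner_uniq k v v' : owner k v -> owner k v' -> v = v'.
Proof.
by move=> /eqP e /eqP; rewrite e => /(pcan_inj pickleK).
Qed.

Definition seat k r := exists (v s : word), [/\ minimal Omega v, owner k v,
  size s = (3 * k + 2)%N, code s = (P ^ (2 * k))%N & r = (v ++ s)%SEQ].

Definition seats : pred word := fun r => `[< exists k, seat k r >].

(** The code records the length of [u]; by [size u < P ^ k] this record fits into the first
    [3 * k + 2] digits below [v], the number of digits that a seat has. *)
Definition spot_at v k s u := [/\ minimal Omega v, owner k v, u = v ++ s,
  (size u < P ^ k)%N && (3 * k + 2 <= size s)%N &
  code s = (P ^ (2 * k + 1) * (1 + P * size u))%N].

Definition spot : pred word := fun u =>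
  `[< exists (v : word) (k : nat) (s : word), spot_at v k s u >].

Definition shifter : Gamma p := graft Omega.
Definition mover : Gamma p := graft seats.
Definition marker : Gamma p := MkGamma (fun u => if spot u then 1 else 0).

Let P_gt1 : (1 < P)%N. Proof. by []. Qed.

Lemma minimal_prefix v v' s s' i : minimal Omega v -> minimal Omega v' ->
  (i <= size (v ++ s))%N -> take i (v ++ s) = v' ++ s' ->
  [/\ v' = v, i = (size v + size s')%N & s = s' ++ drop (size s') s].
Proof.
move=> vm v'm ir e.
have si : i = (size v' + size s')%N.
  by have := congr1 size e; rewrite size_takel// size_cat.
have vv : v' = v.
  apply: (minimal_uniq (u := v ++ s)) v'm vm _ _; last exact: take_size_cat.
  have := congr1 (take (size v')) e; rewrite (take_size_cat s' erefl).
  by rewrite take_takel// si leq_addr.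
subst v'; split=> //.
have := congr1 (drop (size v)) e; rewrite si takeD (take_size_cat s erefl).
by rewrite !drop_size_cat// => {1}<-; rewrite cat_take_drop.
Qed.

(** A proper prefix that is a seat lies below the same [v], and its digits already show the exact
    power of [P] in [code s]; so both seats have the same index, hence the same length. *)
Lemma minimal_seat k r : seat k r -> minimal seats r.
Proof.
move=> rk; split; first by apply/asboolP; exists k.
move: rk => [v [s [vm ok ss cs ->]]] i ir; apply/asboolPn => -[k' [v' [s' [v'm ok' ss' cs' e]]]].
have [vv si es] := minimal_prefix vm v'm (ltnW ir) e; subst v'.
have kk : k = k'.
  have ex m : exact_power P (2 * m)%N (P ^ (2 * m))%N.
    by have := exact_power_exp P_gt1 (2 * m) 0; rewrite muln0 muln1.
  suff : (2 * k = 2 * k')%N by lia.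
  apply: exact_power_uniq (ex k) _.
  have := congr1 (@code p) es; rewrite code_cat cs cs' ss' => ->.
  rewrite (@exact_power_mod _ _ (3 * k' + 2) _ (P ^ (2 * k'))%N) ?ex//; first lia.
  by rewrite addnC mulnC modnMDl.
by move: ir; rewrite si size_cat ss ss' kk ltnn.
Qed.

Lemma act_shifter_root v s t : minimal Omega v ->
  act (shifter ^+ t)%g (v ++ s) = v ++ act (odometer p ^+ t)%g s.
Proof. exact: act_graft_inX. Qed.

(* The mover, conjugated so that its k-th seat covers the spot u, ignores the
   tree below every other spot that is not deeper than u. *)
Lemma mover_ignores v k s u v2 k2 s2 r t q :
  spot_at v k s u -> spot_at v2 k2 s2 r -> r != u ->
  (t + P ^ (2 * k) = code s)%N ->
  act (shifter ^+ t)%g q = r ++ drop (size r) (act (shifter ^+ t)%g q) ->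
  act mover q = q.
Proof.
move=> [vm ok -> /andP[nk sk] cs] [v2m ok2 re /andP[n2k2 sk2] cs2] ru ct eq.
(* [x] is what follows [v2] in the shifted word, and [x'] is what follows it in [q] itself. *)
set x := s2 ++ drop (size r) (act (shifter ^+ t)%g q).
have {}eq : act (shifter ^+ t)%g q = v2 ++ x by rewrite /x catA -re.
pose x' := act (odometer p ^+ t)^-1%g x.
have xx' : act (odometer p ^+ t)%g x' = x by rewrite /x' actVK.
have sx : size x' = size x by rewrite size_act.
have qE : q = v2 ++ x'.
  by apply: (can_inj (actK (shifter ^+ t)%g)); rewrite eq act_shifter_root// xx'.
(* Moving [q] would require a seat as a proper prefix; comparing its code, shifted by [t], with that
   of the spot [r] forces [r = u]. *)
apply: act_graft_out => i iq; apply/asboolPn => -[j [v3 [s3 [v3m ok3 ss3 cs3 e]]]].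
have iq' : (i <= size (v2 ++ x'))%N by rewrite -qE ltnW.
rewrite qE in e.
have [vv _ es] := minimal_prefix v2m v3m iq' e; subst v3.
have s3x : (3 * j + 2 <= size x)%N.
  by rewrite -sx -ss3 es size_cat leq_addr.
have cx : code x = (code x' + t)%N %[mod P ^ (3 * j + 2)].
  have := code_odometerX t x'; rewrite xx' sx => ->.
  by rewrite modn_dvdm// dvdn_exp2l.
have := @spots_separated P P_gt1 k (size (v ++ s)) k2 (size r) j (code x) nk n2k2.
rewrite -cs -cs2 -ct => /(_ _ _)[]//.
- rewrite /x code_cat; apply: eqn_mod_expW sk2 _.
  by rewrite (mulnC (P ^ size s2)%N) addnC; exact: modnMDl.
- have := congr1 (@code p) es; rewrite code_cat cs3 ss3 => cx'.
  rewrite -(modnDml (code x)) cx modnDml cx'.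
  move: (code (drop _ x')) (P ^ (3 * j + 2))%N => D M.
  by rewrite -!addnA addnCA (mulnC M) modnMDl.
- move=> jk kk2 nn; subst j k2.
  have vv := owner_uniq ok2 ok; subst v2.
  case/eqP: ru; rewrite re; congr (_ ++ _); apply: code_inj.
    by move: nn; rewrite re !size_cat; lia.
  by rewrite cs2 nn cs.
Qed.

End Generators.

(** * Commutators with a single relevant label on a level *)

Section Layers.
Variable p : nat.
Local Notation P := (Zp_trunc p).+2.
Local Notation word := (seq 'Z_p).
Implicit Types (g h c y z : Gamma p) (u v w r s : word).

Lemma label_div n g h u : level_stab n (h * g^-1)%g -> size u = n ->
  (h * g^-1)%g u = h u - g u.
Proof.
move=> st un; rewrite labelM labelV; congr (_ - g _).
by rewrite -actMg; apply: st.
Qed.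

Lemma level_stabJ n (k : Gamma p) z : level_stab n k -> level_stab n (z^-1 * k * z)%g.
Proof.
by move=> st u un; rewrite !actMg st ?size_act// actVK.
Qed.

(** Since [k] fixes level [n], the two contributions of [z] cancel, and conjugation only moves the
    labels of [k] along [z]. *)
Lemma label_conj n (k : Gamma p) z u : level_stab n k -> size u = n ->
  (z^-1 * k * z)%g u = k (act z^-1%g u).
Proof.
move=> st un; rewrite !labelM labelV actMg st ?size_act//.
by rewrite addrC addrA subrr add0r.
Qed.

Variable Omega : pred word.
Local Notation marker := (marker Omega).
Local Notation spot := (spot Omega).
Local Notation shifter := (shifter Omega).
Local Notation mover := (mover Omega).

(** The first spot passed on the way down to [u] is reached unmoved, so it is a prefix of the image
    too. *)
Lemma act_marker u : act marker u = u \/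
  exists r, [/\ spot r, (size r < size u)%N, take (size r) u = r &
               take (size r) (act marker u) = r].
Proof.
elim/last_ind: u => [|u x [IH|[r [sr ru ur cur]]]]; first by left.
- rewrite act_rcons IH; have [su|su] := boolP (spot u).
    by right; exists u; rewrite size_rcons ltnSn -!cats1 !take_size_cat.
  by left; rewrite /marker/= (negbTE su) addr0.
- right; exists r; split=> //; first by rewrite size_rcons ltnW.
    by rewrite -cats1 takel_cat// ltnW.
  by rewrite act_rcons -cats1 takel_cat// size_act ltnW.
Qed.

Section Commutator.
Variables (n : nat) (u : word) (y : Gamma p).
Hypotheses (spot_u : spot u) (size_u : size u = n).
Hypothesis y_fix : forall r, spot r -> (size r <= n)%N -> r != u ->
  forall q, take (size r) q = r -> act y q = q.

(** The contributions of [y] cancel: [v'] and its image under [marker] coincide or share as prefix a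
    spot shorter than [n], at and below which [y] has only zero labels. *)
Let conj_label v : (size v <= n)%N ->
  (y^-1 * marker * y)%g v = marker (act y^-1%g v).
Proof.
move=> vn; rewrite !labelM labelV actMg; set v' := act y^-1%g v.
suff -> : y (act marker v') = y v' by rewrite addrC addrA subrr add0r.
have [->//|[r [sr rv v'r cv'r]]] := act_marker v'.
have sz : size v' = size v by rewrite size_act.
have rn : (size r < n)%N by apply: leq_trans vn; rewrite -sz.
have ru : r != u by apply: contraTneq rn => ->; rewrite size_u ltnn.
have y0 w : take (size r) w = r -> y w = 0.
  move=> wr; apply: label_fix => x; apply: (y_fix sr (ltnW rn) ru).
  rewrite -cats1 takel_cat//.
  by rewrite -wr size_take_min geq_minr.
by rewrite !y0.
Qed.

Lemma marker_div_stab : level_stab n (y^-1 * marker * y * marker^-1)%g.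
Proof.
apply/level_stab_div => v vn; rewrite conj_label ?(ltnW vn)//.
have fx r : spot r -> (size r < n)%N -> act y r = r.
  move=> sr rn; apply: (y_fix sr (ltnW rn)); rewrite ?take_size//.
  by apply: contraTneq rn => ->; rewrite size_u ltnn.
have [sv|sv] := boolP (spot v).
  by rewrite -{1}(fx _ sv vn) actK.
rewrite /marker/= (negbTE sv); case: ifPn => // sv'.
by have := fx _ sv'; rewrite size_act actVK => /(_ vn) e; rewrite e sv' in sv.
Qed.

(** On level [n] all spots except possibly [u] are fixed by [y], so conjugation moves a single label
    1, from [u] to its image. *)
Lemma marker_div_label v : size v = n ->
  (y^-1 * marker * y * marker^-1)%g v = (v == act y u)%:R - (v == u)%:R.
Proof.
move=> vn; rewrite (label_div marker_div_stab vn) conj_label ?vn//.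
have fx r : spot r -> size r = n -> r != u -> act y r = r.
  by move=> sr rn ru; apply: (y_fix sr _ ru); rewrite ?take_size ?rn.
set v' := act y^-1%g v.
have vE : v = act y v' by rewrite actVK.
have v'n : size v' = n by rewrite size_act.
have vyu : (v == act y u) = (v' == u).
  by rewrite vE (inj_eq (can_inj (actK y))).
rewrite vyu /marker/=; have [v'u|v'u] := eqVneq v' u.
  rewrite v'u spot_u; congr (_ - _); have [->|vu] := eqVneq v u; first by rewrite spot_u.
  case: ifPn => // sv.
  by have e : v' = v; [rewrite /v' -{1}(fx _ sv vn vu) actK|rewrite -e v'u eqxx in vu].
have [sv'|sv'] := boolP (spot v').
  have e := fx _ sv' v'n v'u; rewrite vE e sv' subrr (negbTE v'u).
  by rewrite subr0.
congr (_ - _); have [->|vu] := eqVneq v u; first by rewrite spot_u.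
case: ifPn => // sv.
by have e : v' = v; [rewrite /v' -{1}(fx _ sv vn vu) actK|rewrite -e (negbTE sv') in sv].
Qed.

End Commutator.

Lemma mover_conj_ignores v k s u v2 k2 s2 r t i q :
  spot_at Omega v k s u -> spot_at Omega v2 k2 s2 r -> r != u ->
  (t + P ^ (2 * k) = code s)%N -> take (size r) q = r ->
  act ((shifter ^+ t)^-1 * mover ^+ i * (shifter ^+ t))%g q = q.
Proof.
move=> su sr ru ct qr; rewrite !actMg; set q' := act _ q.
have qE : act (shifter ^+ t)%g q' = q by rewrite actVK.
suff -> : act (mover ^+ i)%g q' = q' by [].
elim: i => [|i IH]; first by rewrite expg0 act1g.
rewrite expgSr actMg IH; apply: (mover_ignores su sr ru ct).
by rewrite qE -{1}(cat_take_drop (size r) q) qr.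
Qed.

Lemma drop_code_lt L s : (code s < P ^ L)%N -> ~~ has (fun x => x != 0) (drop L s).
Proof.
move=> lt; have [sL|Ls] := leqP (size s) L; first by rewrite drop_oversize.
have : code (drop L s) = 0%N.
  have := lt; rewrite -{1}(cat_take_drop L s) code_cat size_takel ?(ltnW Ls)//.
  move=> /(leq_ltn_trans (leq_addl _ _)).
  by rewrite -[X in (_ < X)%N]muln1 ltn_pmul2l ?expn_gt0// ltnS leqn0 => /eqP.
by move=> /code_eq0 ->; rewrite has_nseq eqxx andbF.
Qed.

Lemma minimal_exists w S : Omega (take S w) ->
  exists2 v, minimal Omega v & [/\ (size v <= S)%N, (size v <= size w)%N & take (size v) w = v].
Proof.
move=> wS; pose Q i := (i <= size w)%N && Omega (take i w).
have exQ : exists i, Q i.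
  exists (minn S (size w)); rewrite /Q geq_minr.
  by rewrite /minn; case: ltnP => [//|h]; rewrite take_size -(take_oversize h).
case: (ex_minnP exQ) => i /andP[iw wi] imin.
have szi : size (take i w) = i by rewrite size_takel.
exists (take i w); rewrite /minimal ?szi; split=> //.
  move=> j ji; rewrite take_takel ?(ltnW ji)//.
  apply/negP => wj; have := imin j; rewrite /Q wj (leq_trans (ltnW ji) iw).
  by move=> /(_ isT); rewrite leqNgt ji.
have [//|Si] := leqP i S.
have := imin S; rewrite /Q wS (leq_trans (ltnW Si) iw).
by move=> /(_ isT); rewrite leqNgt Si.
Qed.

(** The quotient of [marker_div_label] has label 1 at the image of a spot [u] and -1 at [u]. A power
    of the shifter moves the former place to [w] and the latter to a word with zero second half,
    about which nothing is claimed. *)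
Lemma delta_label S n w (H : set (Gamma p)) :
  (forall v, (size v <= S)%N -> exists k,
     [/\ owner k v, (n < P ^ k)%N & (2 * (S + 3 * k + 2) <= n)%N]) ->
  subgroup_set H -> H shifter -> H mover -> H marker ->
  size w = n -> Omega (take S w) -> has (fun x => x != 0) (drop n./2 w) ->
  exists g, [/\ H g, level_stab n g & forall x, size x = n ->
    has (fun d => d != 0) (drop n./2 x) -> g x = (x == w)%:R].
Proof.
move=> owns subH Ha Hb Hc wn wS wtail.
have [v vm [vS vw vpre]] := minimal_exists wS.
have [k [okv nk kn]] := owns v vS.
set L := (3 * k + 2)%N.
pose w' := drop (size v) w; pose m := size w'.
have wE : w = v ++ w' by rewrite -{1}(cat_take_drop (size v) w) vpre.
have mE : (size v + m)%N = n by rewrite -wn wE size_cat.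
have Lm : (L <= m)%N by rewrite /L; clear -mE vS kn; lia.
pose y0 := (P ^ (2 * k + 1) * (1 + P * n))%N.
have y0L : (y0 < P ^ L)%N.
  rewrite /y0 (_ : L = (2 * k + 1) + k.+1)%N; last by rewrite /L; clear; lia.
  rewrite (expnD P (2 * k + 1)) ltn_pmul2l ?expn_gt0// expnS; apply: (@leq_trans (P * n.+1)%N).
    by rewrite mulnS ltn_add2r.
  by rewrite leq_mul2l nk orbT.
have y0m : (y0 < P ^ m)%N by apply: leq_trans y0L _; rewrite leq_exp2l.
have y0k : (P ^ (2 * k) <= y0)%N.
  by rewrite /y0 addn1 expnS -mulnA mulnCA leq_pmulr// muln_gt0.
have [s ss cs] := exists_code y0m.
pose u := v ++ s.
have un : size u = n by rewrite size_cat ss.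
have su : spot_at Omega v k s u by split; rewrite ?un ?nk ?ss.
have uspot : spot u by apply/asboolP; exists v, k, s.
(* Shifting by [t] carries the seat [v ++ b0] onto the first digits of the spot. *)
pose t := (y0 - P ^ (2 * k))%N.
have tE : (t + P ^ (2 * k) = y0)%N by rewrite subnK.
have b0L : (P ^ (2 * k) < P ^ L)%N by apply: leq_ltn_trans y0L.
have [b0 sb0 cb0] := exists_code b0L.
(* [i0] encodes the digits of [w'] beyond the first [L]; the mover produces them, and the final
   shift by [j] corrects the first [L]. The summand [P ^ m] in [j] keeps the subtraction from
   truncating. *)
pose C := code w'; pose i0 := (C %/ P ^ L)%N.
pose y := ((shifter ^+ t)^-1 * mover ^+ i0 * (shifter ^+ t))%g.
pose j := (P ^ m + C %% P ^ L - y0)%N.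
pose z := (shifter ^+ j)%g.
have y_fix r : spot r -> (size r <= n)%N -> r != u ->
    forall q, take (size r) q = r -> act y q = q.
  move=> /asboolP [v2 [k2 [s2 sr]]] _ ru q qr.
  by have := mover_conj_ignores (t := t) i0 su sr ru _ qr; apply; rewrite cs.
have stK := marker_div_stab un y_fix.
have lK := marker_div_label uspot un y_fix.
set K := (y^-1 * marker * y * marker^-1)%g in stK lK.
have P0 e : (0 < P ^ e)%N by rewrite expn_gt0.
have uy : act y u = v ++ act (odometer p ^+ t)%g (b0 ++ act (odometer p ^+ i0)%g (nseq (m - L) 0)).
  have e : u = act (shifter ^+ t)%g (v ++ (b0 ++ nseq (m - L) 0)).
    rewrite act_shifter_root//; congr (_ ++ _); apply: code_inj.
      by rewrite size_act size_cat sb0 size_nseq subnKC.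
    rewrite code_odometerX code_cat code_nseq0 muln0 addn0 cb0 size_cat sb0 size_nseq subnKC//.
    by rewrite addnC tE modn_small.
  rewrite /y !actMg e actK catA.
  have st : seat Omega k (v ++ b0) by exists v, b0.
  by rewrite (act_graft_inX _ _ (minimal_seat st)) -catA act_shifter_root.
have i0m : (i0 < P ^ (m - L))%N.
  by rewrite /i0 ltn_divLR// -expnD subnK// ltn_code.
have yzu : act z (act y u) = w.
  rewrite uy /z act_shifter_root// wE; congr (_ ++ _); apply: code_inj.
    by rewrite !size_act size_cat size_act sb0 size_nseq subnKC.
  rewrite !code_odometerX size_act code_cat code_odometerX code_nseq0 add0n.
  rewrite !size_cat !size_act sb0 size_nseq subnKC// cb0 (modn_small i0m) modnDml.
  have -> : (P ^ (2 * k) + P ^ L * i0 + t + j = C + P ^ m)%N.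
    have arith A B T D E Y : (Y < E -> T + D = Y -> D + A + T + (E + B - Y) = A + B + E)%N.
      by clear; lia.
    rewrite (arith _ _ _ _ _ _ y0m tE); congr (_ + _)%N.
    by rewrite mulnC -divn_eq.
  by rewrite modnDr modn_small ?ltn_code.
(* Below [v] the word [act z u] encodes [C %% P ^ L], so its digits vanish from position
   [size v + L <= n./2] on. *)
have base x : size x = n -> has (fun d => d != 0) (drop n./2 x) -> x != act z u.
  move=> xn; apply: contraTneq => ->; rewrite /z act_shifter_root//.
  set x' := act _ _.
  have cx' : (code x' < P ^ L)%N.
    rewrite code_odometerX ss cs subnKC; last by rewrite ltnW// ltn_addr.
    by rewrite modnDl modn_small ?ltn_pmod// (leq_trans (ltn_pmod _ _))// leq_exp2l.
  have hn : (size v + L <= n./2)%N.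
    by rewrite geq_half_double -mul2n (leq_trans _ kn)// leq_mul2l /= /L addnA !leq_add2r.
  rewrite drop_cat ltnNge (leq_trans (leq_addr _ _) hn)/=.
  rewrite -(subnKC hn) -addnA addKn addnC -drop_drop.
  by apply: contra (drop_code_lt cx') => /hasP[d /mem_drop dx d0]; apply/hasP; exists d.
exists (z^-1 * K * z)%g; split.
- have HV := subgroupV subH; have HM := subgroupM subH; have HX := subgroupX subH.
  have Hy : H y by apply/HM/HX/Ha/HM/HX/Hb/HV/HX/Ha.
  have Hz : H z := HX _ _ Ha.
  by apply/HM/Hz/HM/HM/HV/Hc/HM/Hy/HM/Hc/HV/Hy/HV/Hz.
- exact: level_stabJ.
- move=> x xn xt; rewrite (label_conj z stK)// lK ?size_act//.
  have e a : (act z^-1%g x == a) = (x == act z a).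
    by rewrite -{2}(actVK z x) (inj_eq (can_inj (actK z))).
  by rewrite !e yzu (negbTE (base _ xn xt)) subr0.
Qed.

End Layers.

(** * Prescribing the labels of a level *)

Section FreeCoordinates.
Variable p : nat.
Local Notation P := (Zp_trunc p).+2.
Local Notation word := (seq 'Z_p).
Implicit Types (g h : Gamma p) (u v w r s : word).

Lemma linear_le_expn2 A B : exists q0, forall q, (q0 <= q -> A + B * q <= 2 ^ q)%N.
Proof.
exists (A + B + 4)%N => q qq.
have sq : (q * q <= 2 ^ q)%N.
  have : (4 <= q)%N by lia.
  elim: q {qq} => // q IH; rewrite leq_eqVlt => /predU1P[<-//|q4].
  by rewrite expnS mul2n -addnn; have := IH q4; nia.
by apply: leq_trans sq; nia.
Qed.

Lemma owner_exists S v : exists n0, forall n, (n0 <= n)%N -> exists k,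
  [/\ owner k v, (n < P ^ k)%N & (2 * (S + 3 * k + 2) <= n)%N].
Proof.
pose m := pickle v.
(* The constants expand [2 * (S + 3 * k + 2)] for [k = 2 ^ m * (2 * q + 1)]: the factor [2 ^ m]
   makes [v] the owner, and [k > q] gives [n < P ^ k]. *)
have [q0 q0P] := linear_le_expn2 (2 * S + 6 * 2 ^ m + 4) (12 * 2 ^ m).
exists (2 ^ q0)%N => n n0; set q := trunc_log 2 n.
have n_gt0 : (0 < n)%N by apply: leq_trans n0; rewrite expn_gt0.
have /andP[nq qn] := trunc_log_bounds (isT : (1 < 2)%N) n_gt0.
exists (2 ^ m * (2 * q + 1))%N; split.
- rewrite /owner lognM ?expn_gt0 ?addn1// pfactorK//.
  by rewrite (@lognE 2 (2 * q).+1) /= dvdn2 /= mul2n odd_double addn0.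
- apply: leq_trans qn _; apply: (@leq_trans (P ^ q.+1)); first by rewrite leq_exp2r.
  rewrite leq_exp2l//; have : (0 < 2 ^ m)%N by rewrite expn_gt0.
  by move: (2 ^ m)%N => e; rewrite -/q; nia.
- apply: leq_trans nq; rewrite -/q; apply: leq_trans (q0P q _); first by move: (2 ^ m)%N => e; nia.
  by apply: trunc_log_max.
Qed.

(** Only finitely many words have length at most [S], so their thresholds have a maximum. *)
Lemma eventually_uniform (Q : word -> nat -> Prop) S :
  (forall v, exists n0, forall n, (n0 <= n)%N -> Q v n) ->
  exists n0, forall n, (n0 <= n)%N -> forall v, (size v <= S)%N -> Q v n.
Proof.
move=> /choice[f fP].
exists (\max_(i < S.+1) \max_(t : i.-tuple 'Z_p) f t) => n nn v vS.
apply: fP; apply: leq_trans nn.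
have lt : (size v < S.+1)%N by [].
apply: leq_trans (leq_bigmax (Ordinal lt)).
exact: (leq_bigmax (in_tuple v)).
Qed.

Lemma level_stab_label n g u : level_stab n g -> (size u < n)%N -> g u = 0.
Proof.
move=> gn un; have : level_stab n (g * 1^-1)%g by rewrite invg1 mulg1.
by move/level_stab_div => /(_ u un).
Qed.

Lemma level_stab_act n g u : level_stab n g -> (size u <= n)%N -> act g u = u.
Proof.
move=> gn un; have gn' : level_stab n (g * 1^-1)%g by rewrite invg1 mulg1.
by have := level_stab_div_le un gn' (erefl (size u)); rewrite invg1 mulg1.
Qed.

Lemma label_stabM n g h u : level_stab n g -> (size u <= n)%N ->
  (g * h)%g u = g u + h u.
Proof. by move=> gn un; rewrite labelM (level_stab_act gn). Qed.

Lemma level_stabM n g h : level_stab n g -> level_stab n h -> level_stab n (g * h)%g.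
Proof. by move=> gn hn u un; rewrite actMg gn// hn. Qed.

Lemma level_stab1 n : level_stab n (1%g : Gamma p).
Proof. by move=> u _; rewrite act1g. Qed.

Lemma level_stabX n g m : level_stab n g -> level_stab n (g ^+ m)%g.
Proof.
by move=> gn; elim: m => [|m IH]; rewrite ?expgS; [exact: level_stab1|exact: level_stabM].
Qed.

Lemma label_stabX n g m u : level_stab n g -> (size u <= n)%N ->
  (g ^+ m)%g u = g u *+ m.
Proof.
move=> gn un; elim: m => [|m IH]; first by rewrite expg0.
by rewrite expgS (label_stabM _ gn)// IH mulrS.
Qed.

Section PrescribedLabels.
Variable H : set (Gamma p).
Hypothesis subH : subgroup_set H.

(** Labels at level [n] add up on the stabilizer of that level, so [g] can be corrected one word at
    a time by powers of the given elements. *)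
Lemma free_coordinates n (D : pred word) :
  (forall w, size w = n -> D w -> exists g, [/\ H g, level_stab n g &
     forall x, size x = n -> D x -> g x = (x == w)%:R]) ->
  forall g (phi : word -> 'Z_p), H g -> exists2 g', H g' &
    (forall u, (size u < n)%N -> g' u = g u) /\
    (forall u, size u = n -> D u -> g' u = phi u).
Proof.
move=> delta g phi Hg; pose psi u := phi u - g u.
have partial (l : seq (n.-tuple 'Z_p)) : uniq l -> exists k, [/\ H k, level_stab n k &
    forall x : n.-tuple 'Z_p, D x -> k x = if x \in l then psi x else 0].
  elim: l => [_|w l IH /= /andP[wl ul]].
    by exists 1%g; split; [exact: subH.1|exact: level_stab1|].
  have [k [Hk stk kE]] := IH ul.
  have [Dw|Dw] := boolP (D w); last first.
    exists k; split=> // x Dx; rewrite kE// inE; case: eqVneq => //= xw.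
    by rewrite -xw Dx in Dw.
  have [d [Hd std dE]] := delta w (size_tuple w) Dw.
  exists (d ^+ (psi w : nat) * k)%g; split.
  - by apply: (subgroupM subH) => //; exact: (subgroupX subH).
  - exact/level_stabM/stk/level_stabX.
  - move=> x Dx; have xn := size_tuple x.
    rewrite (label_stabM _ (level_stabX _ std)) ?xn// (label_stabX _ std) ?xn//.
    rewrite dE// kE// inE; have [->|xw] := eqVneq x w.
      by rewrite eqxx (negbTE wl) addr0 natr_Zp.
    by rewrite -[_ == _ :> seq _]/(x == w) (negbTE xw) mul0rn add0r.
have [k [Hk stk kE]] := partial _ (enum_uniq {: n.-tuple 'Z_p}).
exists (k * g)%g; first exact: (subgroupM subH).
split=> u un; rewrite (label_stabM _ stk) ?un ?(ltnW un)//.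
  by rewrite (level_stab_label stk un) add0r.
move=> Du; have ut : size u == n by apply/eqP.
have := kE (Tuple ut) Du; rewrite mem_enum /= => ->.
by rewrite /psi subrK.
Qed.

End PrescribedLabels.

Section Support.
Variable Omega : pred word.

Definition supported : set (Gamma p) := [set g | forall u, ~~ Omega u -> g u = 0].

Hypothesis Omega_rcons : forall u x, Omega u -> Omega (rcons u x).

Lemma Omega_cat u v : Omega u -> Omega (u ++ v).
Proof.
move=> Ou; elim/last_ind: v => [|v x IH]; first by rewrite cats0.
by rewrite -rcons_cat; exact: Omega_rcons.
Qed.

Lemma Omega_take u i : Omega (take i u) -> Omega u.
Proof. by move=> /Omega_cat-/(_ (drop i u)); rewrite cat_take_drop. Qed.

(** All prefixes of a word outside [Omega] lie outside as well and carry the label 0. *)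
Lemma supported_act g u : supported g -> ~~ Omega u -> act g u = u.
Proof.
move=> gO; elim/last_ind: u => [//|u x IH] Ou.
have Ou' : ~~ Omega u by apply: contra Ou; exact: Omega_rcons.
by rewrite act_rcons IH// gO// addr0.
Qed.

Lemma supported_subgroup : subgroup_set supported.
Proof.
split=> [//|g h gO hO] u Ou.
rewrite labelM labelV (supported_act gO)// gO// add0r.
suff -> : act h^-1%g u = u by rewrite hO ?oppr0.
by rewrite -{1}(supported_act hO Ou) actK.
Qed.

Lemma supported_shifter : supported (shifter Omega).
Proof.
by move=> u Ou; apply: graft_out => i _; apply: contra Ou; exact: Omega_take.
Qed.

Lemma supported_mover : supported (mover Omega).
Proof.
move=> u Ou; apply: graft_out => i _; apply/asboolPn => -[k [v [s [[Ov _] _ _ _ e]]]].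
by case/negP: Ou; apply: (@Omega_take u i); rewrite e; exact: Omega_cat.
Qed.

Lemma supported_marker : supported (marker Omega).
Proof.
move=> u Ou; rewrite /marker/=; case: ifPn => // /asboolP[v [k [s [[Ov _] _ e _ _]]]].
by case/negP: Ou; rewrite e; exact: Omega_cat.
Qed.

Definition spread : set (Gamma p) :=
  generated [set shifter Omega; mover Omega; marker Omega].

Lemma spread_subgroup : subgroup_set spread.
Proof.
split=> [|g h gG hG] K [subK SK]; first exact: subK.1.
by apply: subK.2; [exact: gG|exact: hG].
Qed.

Lemma spread_supported : spread `<=` supported.
Proof.
move=> g; apply; split; first exact: supported_subgroup.
move=> _ [[]|] ->; [exact: supported_shifter|exact: supported_mover|exact: supported_marker].
Qed.

Lemma spread_free S : exists n0, forall n, (n0 <= n)%N ->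
  forall g (phi : word -> 'Z_p), spread g -> exists2 g', spread g' &
    (forall u, (size u < n)%N -> g' u = g u) /\
    (forall u, size u = n -> Omega (take S u) && has (fun d => d != 0) (drop n./2 u) ->
       g' u = phi u).
Proof.
have [n0 owns] := eventually_uniform S (owner_exists S).
have gen x : [set shifter Omega; mover Omega; marker Omega] x -> spread x.
  by move=> Sx K [_]; apply.
exists n0 => n nn; apply: free_coordinates; first exact: spread_subgroup.
move=> w wn /andP[wS wt].
have Ha : spread (shifter Omega) by apply: gen; left; left.
have Hb : spread (mover Omega) by apply: gen; left; right.
have Hc : spread (marker Omega) by apply: gen; right.
have [g [Hg gn gE]] := delta_label (owns n nn) spread_subgroup Ha Hb Hc wn wS wt.
by exists g; split=> // x xn /andP[_ xt]; exact: gE.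
Qed.

End Support.
End FreeCoordinates.

(** * Hausdorff dimension *)

Section Cosets.
Variable p : nat.
Local Notation P := (Zp_trunc p).+2.
Local Notation word := (seq 'Z_p).
Implicit Types (g h x y : Gamma p) (u v w r s : word).

Definition agree n g h := forall u, (size u < n)%N -> g u = h u.

Lemma agree_sym n g h : agree n g h -> agree n h g.
Proof. by move=> gh u un; rewrite gh. Qed.

Lemma agree_trans n g h k : agree n g h -> agree n h k -> agree n g k.
Proof. by move=> gh hk u un; rewrite gh// hk. Qed.

Lemma agree_le m n g h : (m <= n)%N -> agree n g h -> agree m g h.
Proof. by move=> mn gh u um; apply: gh; exact: leq_trans mn. Qed.

Lemma agree_dist (R : realType) n g h :
  Gamma_dist R g h <= (Gamma_order p n)%:R^-1 <-> agree n g h.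
Proof. by rewrite Gamma_dist_le level_stab_div. Qed.

Lemma Gamma_order_gt0 n : (0 < Gamma_order p n)%N.
Proof. exact: leq_ltn_trans (Gamma_order_gt p n). Qed.

Lemma closureP (H : set (Gamma p)) x :
  closure H x <-> forall n, exists2 g, H g & agree n x g.
Proof.
split=> [Hx n|Hx B /nbhsP[A [n _ nA] AB]].
  have : nbhs x [set h | agree n x h].
    apply/nbhsP; exists [set gh : Gamma p * Gamma p | level_stab n (gh.1 * gh.2^-1)%g].
      by exists n.
    by move=> h /xsectionP /level_stab_div.
  by move=> /Hx[g [Hg xg]]; exists g.
have [g Hg xg] := Hx n; exists g; split=> //; apply: AB.
by apply/xsectionP; apply: nA => /=; apply/level_stab_div.
Qed.

Section Greedy.
Variables (R : realType) (H : set (Gamma p)) (F : nat -> pred word).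
Hypothesis freeH : forall n g (phi : word -> 'Z_p), H g -> exists2 g', H g' &
  agree n g' g /\ (forall u, size u = n -> F n u -> g' u = phi u).

Definition free_count n := #|[pred t : n.-tuple 'Z_p | F n t]|.
Definition branching n := (P ^ \sum_(i < n) free_count i)%N.
Local Notation rho n := ((branching n)%:R^-1 : R).

Variables (nonempty : pred nat) (y : nat -> Gamma p) (m : nat -> nat).

(** The [i]-th coset burdens the partial choice [g] only as long as it lies inside the coset of [g]
    at level [n]. *)
Let load n g i : \bar R :=
  if [&& nonempty i, (n <= m i)%N & `[< agree n g (y i) >]] then (rho (m i))%:E else 0%E.

Let load_ge0 n g i : (0 <= load n g i)%E.
Proof. by rewrite /load; case: ifP. Qed.

(** The choices of free labels on level [n] give disjoint children, whose loads add up to at most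
    the load of [g]; if each reached [rho n.+1], the sum would reach [rho n]. *)
Let step n g : H g -> (\sum_(0 <= i <oo) load n g i < (rho n)%:E)%E ->
  exists g', [/\ H g', agree n g' g &
    (\sum_(0 <= i <oo) load n.+1 g' i < (rho n.+1)%:E)%E].
Proof.
move=> Hg lt; pose T := {t : n.-tuple 'Z_p | F n t}.
have child (psi : {ffun T -> 'Z_p}) : exists g', [/\ H g', agree n g' g &
    forall t : T, g' (val t) = psi t].
  pose phi u := if [pick t : T | val (val t) == u] is Some t then psi t else 0.
  have [g' Hg' [g'g g'phi]] := freeH n phi Hg; exists g'; split=> // t.
  rewrite g'phi ?size_tuple//; last exact: valP t.
  rewrite /phi; case: pickP => [t' /eqP tt'|/(_ t)]; last by rewrite eqxx.
  by congr (psi _); apply: val_inj; apply: val_inj.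
have [G GP] := choice child.
apply: contrapT => none.
have ge psi : ((rho n.+1)%:E <= \sum_(0 <= i <oo) load n.+1 (G psi) i)%E.
  rewrite leNgt; apply/negP => l; apply: none.
  by have [HG Gg _] := GP psi; exists (G psi).
have cardT : #|{: {ffun T -> 'Z_p}}| = (P ^ free_count n)%N.
  by rewrite card_ffun card_ord card_sig.
move: lt; rewrite ltNge => /negP; apply.
apply: (@le_trans _ _ (\sum_(psi : {ffun T -> 'Z_p}) (rho n.+1)%:E)%E).
  rewrite sumEFin sumr_const cardT lee_fin /branching big_ord_recr/= expnD.
  by rewrite natrM invfM -[leRHS]mulr_natr -mulrA mulVf ?mulr1// pnatr_eq0 expn_eq0.
apply: (@le_trans _ _ (\sum_(psi : {ffun T -> 'Z_p}) \sum_(0 <= i <oo) load n.+1 (G psi) i)%E).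
  by apply: lee_sum => psi _; exact: ge.
rewrite -nneseries_sum//; apply: lee_nneseries => [i _ _|i _].
  by apply: sume_ge0 => psi _; exact: load_ge0.
(* A coset of depth greater than [n] fixes all labels on level [n], so it burdens at most one
   child. *)
have [[psi psiP]|no] := pselect (exists psi, load n.+1 (G psi) i != 0%E).
  rewrite (bigD1 psi)//= big1 ?adde0.
    move: psiP; rewrite /load; case: ifPn => [/and3P[ei mi /asboolP ag] _|]; last by rewrite eqxx.
    rewrite ei (ltnW mi)/=; case: asboolP => // -[].
    have [_ Gg _] := GP psi; apply: agree_trans (agree_sym Gg) _.
    exact: agree_le ag.
  move=> psi' /eqP pp; apply/eqP; apply: contrapT => /negP psi'P; apply: pp.
  move: psiP psi'P; rewrite /load.
  case: ifPn => [/and3P[_ _ /asboolP ag] _|]; last by rewrite eqxx.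
  case: ifPn => [/and3P[_ _ /asboolP ag'] _|]; last by rewrite eqxx.
  apply/ffunP => t; have [_ _ <-] := GP psi; have [_ _ <-] := GP psi'.
  by rewrite ag ?ag' ?size_tuple.
rewrite big1// => psi _; apply/eqP; apply: contrapT => /negP q; apply: no.
by exists psi.
Qed.

Lemma uncovered_point g0 : H g0 ->
  (\sum_(0 <= i <oo | nonempty i) (rho (m i))%:E < 1)%E ->
  exists2 x, closure H x & forall i, nonempty i -> ~ agree (m i) x (y i).
Proof.
move=> Hg0 lt1.
pose X := {ng : nat * Gamma p | H ng.2 /\
  (\sum_(0 <= i <oo) load ng.1 ng.2 i < (rho ng.1)%:E)%E}.
pose next (a b : X) := (sval b).1 = (sval a).1.+1 /\ agree (sval a).1 (sval b).2 (sval a).2.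
have start : H g0 /\ (\sum_(0 <= i <oo) load 0 g0 i < (rho 0)%:E)%E.
  split=> //; rewrite /branching big_ord0 expn0 invr1.
  apply: le_lt_trans lt1; rewrite [leRHS]eseries_mkcond.
  by apply: lee_nneseries => // i _; rewrite /load; case: (nonempty i) => //=; case: ifP.
have nextP (a : X) : {b : X | next a b}.
  case: a => [[n g] /= [Hg lt]]; apply: cid.
  have [g' [Hg' g'g lt']] := step Hg lt.
  by exists (exist _ (n.+1, g') (conj Hg' lt')).
have [f [f0 fS]] := dependent_choice nextP (exist _ (0%N, g0) start).
have fn n : (sval (f n)).1 = n.
  by elim: n => [|n IH]; [rewrite f0|rewrite (fS n).1 IH].
pose G n := (sval (f n)).2.
have GS n : agree n (G n.+1) (G n) by have := (fS n).2; rewrite fn.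
have Gle n k : (n <= k)%N -> agree n (G k) (G n).
  move=> nk; rewrite -(subnKC nk); elim: (k - n)%N => [|d IH]; first by rewrite addn0.
  by rewrite addnS; apply: agree_trans IH; apply: agree_le (GS _); rewrite leq_addr.
(* [G n] is final only below level [n], so the label at [u] is read off at stage [(size u).+1]. *)
pose x := MkGamma (fun u => G (size u).+1 u).
have xG n : agree n x (G n).
  by move=> u un /=; rewrite (Gle _ _ un).
exists x.
  by apply/closureP => n; exists (G n) => //; case: (svalP (f n)).
move=> i ei xi.
(* If the limit lay in the [i]-th coset, that coset alone would bring the load at stage [m i] up to
   the strict bound [rho (m i)]. *)
have [_] := svalP (f (m i)); rewrite fn ltNge => /negP; apply.
apply: le_trans (nneseries_lim_ge i.+1 _); last by move=> *; exact: load_ge0.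
rewrite big_nat_recr//= -[leLHS]add0e; apply: leeD; first by apply: sume_ge0.
rewrite /load ei leqnn/=; case: asboolP => // -[].
exact: agree_trans (agree_sym (xG _)) xi.
Qed.

End Greedy.
End Cosets.

(** * Diameters and the lower bound for Hausdorff measures *)

Section Diameter.
Variables (R : realType) (p : nat).
Local Notation P := (Zp_trunc p).+2.
Local Notation word := (seq 'Z_p).
Local Notation order n := ((Gamma_order p n)%:R : R).
Implicit Types (g h x y : Gamma p) (U : set (Gamma p)).

Lemma mdist_le_diam U x y : U x -> U y -> ((Gamma_dist R x y)%:E <= diam U)%E.
Proof. by move=> Ux Uy; apply: ereal_sup_ubound; exists x, y. Qed.

Lemma diam_ge0 U : U !=set0 -> (0 <= @diam R _ U)%E.
Proof.
move=> [x Ux]; apply: le_trans (mdist_le_diam Ux Ux).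
by rewrite lee_fin Gamma_dist_ge0.
Qed.

Lemma diam_le n U : (forall x y, U x -> U y -> agree n x y) ->
  (@diam R _ U <= ((order n)^-1)%:E)%E.
Proof.
move=> Un; apply: ge_ereal_sup => _ [x [y [Ux Uy ->]]].
by rewrite lee_fin; apply/agree_dist/Un.
Qed.

Lemma diam_agree n U x y : (@diam R _ U <= ((order n)^-1)%:E)%E ->
  U x -> U y -> agree n x y.
Proof.
move=> Un Ux Uy; apply/(agree_dist R); rewrite -lee_fin.
exact: le_trans (mdist_le_diam Ux Uy) Un.
Qed.

(** Take the least level at which agreement fails. It is not 0, where agreement is vacuous, and a
    pair that disagrees there bounds the diameter from below. *)
Lemma set1_or_diam U : (forall n x y, U x -> U y -> agree n x y) \/
  exists2 n, (forall x y, U x -> U y -> agree n x y) &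
             (((order n)^-1)%:E <= @diam R _ U)%E.
Proof.
pose Q n := `[< ~ forall x y, U x -> U y -> agree n x y >].
have [exQ|] := pselect (exists n, Q n); last first.
  move=> /forallNP noQ; left => n.
  by apply: contrapT => q; apply: (noQ n); exact/asboolP.
right; have [[|n] /asboolP Qn nmin] := ex_minnP exQ; first by case: Qn.
exists n.
  apply: contrapT => q; suff : (n < n)%N by rewrite ltnn.
  by apply: nmin; exact/asboolP.
move: Qn => /existsNP[x /existsNP[y /not_implyP[Ux /not_implyP[Uy nxy]]]].
apply: le_trans (mdist_le_diam Ux Uy); rewrite lee_fin.
have xy : x != y by apply/eqP => e; apply: nxy; rewrite e.
rewrite /Gamma_dist (negbTE xy) lef_pV2 ?posrE ?ltr0n ?Gamma_order_gt0//.
rewrite ler_nat leq_Gamma_order leqNgt; apply/negP => lt; apply: nxy.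
by apply/level_stab_div/depth_div.
Qed.

Lemma Gamma_order_powR_large (s M : R) : 0 < s -> exists n0, forall n, (n0 <= n)%N ->
  M <= order n `^ s.
Proof.
move=> s0; pose M' := Num.max M 1.
have M'0 : 0 <= M' by rewrite le_max ler01 orbT.
exists (Num.truncn (M' `^ s^-1)).+1 => n nn.
apply: (@le_trans _ _ M'); first by rewrite le_max lexx.
have -> : M' = (M' `^ s^-1) `^ s by rewrite -powRrM mulVf ?gt_eqF// powRr1.
apply: ge0_ler_powR; rewrite ?nnegrE ?powR_ge0 ?ler0n//; first exact: ltW.
apply/ltW/(lt_le_trans (truncnS_gt _)); rewrite ler_nat (leq_trans nn)//.
exact/ltnW/Gamma_order_gt.
Qed.

Lemma order_inv_powR n (s : R) : ((order n)^-1) `^ s = (order n `^ s)^-1.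
Proof.
by rewrite -powR_inv1 ?ler0n// -!powRrM mulrC -powRN mulrN1.
Qed.

Lemma poweR_mono (s : R) (a b : \bar R) : 0 <= s -> (0 <= a)%E -> (a <= b)%E ->
  (poweR a s <= poweR b s)%E.
Proof.
move=> s0 a0 ab; apply: gt0_ler_poweR => //; rewrite in_itv/= leey andbT//.
exact: le_trans ab.
Qed.

Lemma hausdorff_weight_ge0 (s : R) U : (0 <= hausdorff_weight s U)%E.
Proof. by rewrite /hausdorff_weight; case: ifP => // _; exact: poweR_ge0. Qed.

Lemma hausdorff_pre_ge0 (s d : R) (E : set (Gamma p)) : (0 <= hausdorff_pre s d E)%E.
Proof.
apply: le_ereal_inf_tmp => _ [U _ <-]; apply: nneseries_ge0 => i _ _.
exact: hausdorff_weight_ge0.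
Qed.

(** Each set of a cheap cover is replaced by a coset whose inverse [branching] is at most the weight
    of the set plus [e i]; the total stays below 1, against [uncovered_point]. *)
Lemma hausdorff_lower (H : set (Gamma p)) (F : nat -> pred word) (s s' : R) :
  H !=set0 ->
  (forall n g (phi : word -> 'Z_p), H g -> exists2 g', H g' &
    agree n g' g /\ (forall u, size u = n -> F n u -> g' u = phi u)) ->
  0 <= s <= s' -> 0 < s' ->
  (exists n0, forall n, (n0 <= n)%N -> order n `^ s' <= (branching F n)%:R) ->
  hausdorff_measure s (closure H) != 0%E.
Proof.
move=> [g0 Hg0] freeH /andP[s0 ss'] s'0 [n0 n0P]; apply/eqP => measure0.
have order0 n : 0 < order n by rewrite ltr0n Gamma_order_gt0.
have order1 n : 1 <= order n by rewrite ler1n Gamma_order_gt0.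
have rho_le n : (n0 <= n)%N -> (branching F n)%:R^-1 <= (order n `^ s')^-1.
  move=> nn; rewrite lef_pV2 ?posrE ?powR_gt0// ?n0P//.
  by rewrite ltr0n expn_gt0.
(* At scale [(order n0)^-1] the points of each covering set agree up to level [n0], so its coset can
   be taken at a depth where the growth bound applies. *)
have pre_lt : (hausdorff_pre s (order n0)^-1 (closure H) < (2^-1)%:E)%E.
  apply: (@le_lt_trans _ _ 0%E); last by rewrite lte_fin invr_gt0.
  rewrite -measure0; apply: ereal_sup_ubound; exists (order n0)^-1 => //=.
  by rewrite invr_gt0.
have [_ [U [cover small] <-] sum_lt] := ereal_inf_lt pre_lt.
(* The errors sum to 1/2, the weights to less than 1/2. Errors serve the single points, whose weight
   may vanish. *)
pose e i : R := 2^-1 / (2 ^ i.+1)%:R.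
have e0 i : 0 < e i by rewrite divr_gt0// ?invr_gt0// ltr0n expn_gt0.
pose good i (ym : Gamma p * nat) := U i !=set0 ->
  (forall x, U i x -> agree ym.2 x ym.1) /\
  (((branching F ym.2)%:R^-1)%:E <= hausdorff_weight s (U i) + (e i)%:E)%E.
have exgood i : exists ym, good i ym.
  have [[y Uy]|noU] := pselect (U i !=set0); last by exists (g0, 0%N) => /noU.
  have U0 : U i != set0 by apply/set0P; exists y.
  have [single|[n Un nU]] := set1_or_diam (U i).
    have [n1 n1P] := Gamma_order_powR_large (e i)^-1 s'0.
    exists (y, maxn n0 n1) => _; split=> [x Ux|]; first exact: single.
    apply: (@le_trans _ _ (e i)%:E); last first.
      by rewrite leeDr// hausdorff_weight_ge0.
    rewrite lee_fin; apply: le_trans (rho_le _ (leq_maxl _ _)) _.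
    rewrite invf_ple ?posrE ?powR_gt0//; apply: n1P; exact: leq_maxr.
  exists (y, maxn n0 n) => _; split=> [x Ux /=|].
    by rewrite /maxn; case: ifP => _; [exact: Un|exact: diam_agree (small i) Ux Uy].
  apply: (@le_trans _ _ (hausdorff_weight s (U i))); last by rewrite leeDl// lee_fin ltW.
  rewrite /hausdorff_weight (negbTE U0).
  apply: (@le_trans _ _ (poweR ((order (maxn n0 n))^-1)%:E s)).
    rewrite poweR_EFin lee_fin order_inv_powR.
    apply: le_trans (rho_le _ (leq_maxl _ _)) _.
    by rewrite lef_pV2 ?posrE ?powR_gt0// ler_powR.
  apply: poweR_mono => //.
  apply: le_trans nU; rewrite lee_fin lef_pV2 ?posrE// ler_nat leq_Gamma_order.
  exact: leq_maxr.
have [f fP] := choice exgood.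
pose nonempty i := U i != set0.
have [||x Hx xP] := @uncovered_point p R H F freeH nonempty (fst \o f) (snd \o f) g0.
- exact: Hg0.
- apply: (@le_lt_trans _ _ (\sum_(0 <= i <oo | nonempty i)
      (hausdorff_weight s (U i) + (e i)%:E))%E).
    apply: lee_nneseries => i; first by move=> _ _; rewrite lee_fin invr_ge0.
    by move=> Ui; have [|_] := fP i; first exact/set0P.
  apply: le_lt_trans (@epsilon_trick R _ 2^-1 _ _ _) _.
  + by move=> i; exact: hausdorff_weight_ge0.
  + by rewrite invr_ge0.
  + rewrite [ltRHS](_ : _ = (2^-1)%:E + (2^-1)%:E)%E; last first.
      by rewrite -EFinD -[in RHS](mul1r 2^-1) -splitr.
    rewrite lteD2rE//; apply: le_lt_trans sum_lt.
    rewrite [leLHS]eseries_mkcond; apply: lee_nneseries => i _.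
      by move=> _; case: ifP => // _; exact: hausdorff_weight_ge0.
    by case: ifP => // _; exact: hausdorff_weight_ge0.
- have [i _ Ux] := cover _ Hx.
  have ne : U i !=set0 by exists x.
  apply: (xP i); first exact/set0P.
  by have [ag _] := fP i ne; exact: ag.
Qed.

End Diameter.

(** * Upper bound for the Hausdorff dimension *)

Section UpperBound.
Variables (R : realType) (p : nat).
Local Notation P := (Zp_trunc p).+2.
Local Notation word := (seq 'Z_p).
Local Notation order n := ((Gamma_order p n)%:R : R).
Implicit Types (g h x y : Gamma p) (u : word).

(** Above level [n], elements of [E] are determined by their labels on [Omega]. This gives a cover
    by [branching] many sets of diameter at most [(order n)^-1], whose total weight is at most
    [order n] to the negative power [l - s]. *)
Lemma hausdorff_upper (Omega : pred word) (E : set (Gamma p)) (s l : R) :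
  E `<=` supported Omega -> 0 <= s -> l < s ->
  (forall n, (branching (fun=> Omega) n)%:R <= order n `^ l) ->
  hausdorff_measure s E = 0%E.
Proof.
move=> EO s0 ls count.
have order0 n : 0 < order n by rewrite ltr0n Gamma_order_gt0.
have sl0 : 0 < s - l by rewrite subr_gt0.
suff pre0 d : 0 < d -> (hausdorff_pre s d E <= 0)%E.
  apply/eqP; rewrite eq_le; apply/andP; split.
    by apply: ge_ereal_sup => _ [d d0 <-]; exact: pre0.
  apply: le_trans (hausdorff_pre_ge0 s 1 E) _.
  by apply: ereal_sup_ubound; exists 1 => //=; exact: ltr01.
move=> d0; apply/lee_addgt0Pr => e e0; rewrite add0e.
have [n1 n1P] := @Gamma_order_powR_large R p _ d^-1 ltr01.
have [n2 n2P] := @Gamma_order_powR_large R p _ e^-1 sl0.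
pose n := maxn n1 n2.
have nd : (order n)^-1 <= d.
  rewrite invf_ple ?posrE//; have := n1P n (leq_maxl _ _).
  by rewrite powRr1 ?ler0n.
have ne : (order n `^ (s - l))^-1 <= e.
  by rewrite invf_ple ?posrE ?powR_gt0//; exact: n2P (leq_maxr _ _).
pose W := {i : 'I_n & {t : (i : nat).-tuple 'Z_p | Omega t}}.
pose T := {ffun W -> 'Z_p}.
have cardT : #|{: T}| = branching (fun=> Omega) n.
  rewrite card_ffun card_ord /branching; congr (_ ^ _)%N.
  rewrite card_tagged sumnE big_map big_enum/=.
  by apply: eq_bigr => i _; rewrite card_sig.
(* From index [#|{: T}|] on the sets are empty and weigh 0 by convention. *)
pose U i := [set g | [/\ (i < #|{: T}|)%N, E g & forall w : W,
  g (val (val (tagged w))) = nth [ffun=> 0] (enum {: T}) i w]].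
have Uagree i x y : U i x -> U i y -> agree n x y.
  move=> [_ Ex xU] [_ Ey yU] u un; have [Ou|Ou] := boolP (Omega u); last first.
    by rewrite (EO _ Ex _ Ou) (EO _ Ey _ Ou).
  pose w : W := Tagged (fun i : 'I_n => {t : (i : nat).-tuple 'Z_p | Omega t})
    (exist _ (in_tuple u : (Ordinal un : nat).-tuple 'Z_p) Ou).
  by rewrite -[u]/(val (val (tagged w))) xU yU.
have Udiam i : (@diam R _ (U i) <= ((order n)^-1)%:E)%E.
  by apply: diam_le => x y; exact: Uagree.
have w0 i : (0 <= @hausdorff_weight R _ s (U i))%E by exact: hausdorff_weight_ge0.
have wU i : (@hausdorff_weight R _ s (U i) <= ((order n `^ s)^-1)%:E)%E.
  rewrite /hausdorff_weight; case: ifPn => [_|/set0P U0].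
    by rewrite lee_fin invr_ge0 powR_ge0.
  rewrite -order_inv_powR -poweR_EFin; apply: poweR_mono => //.
  exact: diam_ge0.
apply: (@le_trans _ _ (\sum_(0 <= i <oo) @hausdorff_weight R _ s (U i))%E).
  apply: ereal_inf_lbound; exists U => //; split=> [g Eg|i]; last first.
    by apply: le_trans (Udiam i) _; rewrite lee_fin.
  pose phi : T := [ffun w => g (val (val (tagged w)))].
  exists (index phi (enum {: T})) => //; split=> //.
    by rewrite cardE index_mem mem_enum.
  by move=> w; rewrite nth_index ?mem_enum// ffunE.
rewrite (nneseries_split 0 #|{: T}|)// add0n eseries0 ?adde0; last first.
  move=> i Ti _; rewrite /hausdorff_weight (_ : U i = set0) ?eqxx//.
  by apply/seteqP; split=> // g [] /=; rewrite ltnNge Ti.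
apply: (@le_trans _ _ (\sum_(0 <= i < #|{: T}|) ((order n `^ s)^-1)%:E)%E).
  by apply: lee_sum => i _; exact: wU.
rewrite sumEFin sumr_const_nat subn0 cardT lee_fin -[leLHS]mulr_natl.
apply: le_trans ne.
apply: (@le_trans _ _ (order n `^ l / order n `^ s)).
  by rewrite ler_pM2r ?invr_gt0 ?powR_gt0.
by rewrite -[leRHS]powRN opprB powRB ?(lt_eqF ls).
Qed.

Lemma hausdorff_dimP (E : set (Gamma p)) (l : R) :
  (forall s, 0 <= s -> l < s -> hausdorff_measure s E = 0%E) ->
  (forall s, 0 <= s < l -> hausdorff_measure s E != 0%E) -> 0 <= l ->
  @hausdorff_dim R _ E = l%:E.
Proof.
move=> above below l0; apply/eqP; rewrite eq_le; apply/andP; split.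
  apply/lee_addgt0Pr => e e0; apply: ereal_inf_lbound; exists (l + e) => //.
  have le0 : 0 <= l + e by rewrite addr_ge0// ltW.
  by split=> //; apply: above; rewrite ?ltrDl.
apply: le_ereal_inf_tmp => _ [s [s0 sE] <-]; rewrite lee_fin leNgt.
by apply/negP => sl; have := below s; rewrite s0 sl sE eqxx => /(_ isT).
Qed.

End UpperBound.

(** * Counting words *)

Section Counting.
Variable p : nat.
Local Notation P := (Zp_trunc p).+2.
Local Notation word := (seq 'Z_p).

Lemma card_ord_lt N m : (m <= N)%N -> #|[pred i : 'I_N | (i < m)%N]| = m.
Proof.
move=> mN; rewrite -sum1_card -[RHS]card_ord -sum1_card.
by rewrite (big_ord_widen N (fun=> 1%N) mN).
Qed.

Lemma card_code_lt n m : (m <= P ^ n)%N ->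
  #|[pred t : n.-tuple 'Z_p | (code (rev t) < m)%N]| = m.
Proof.
move=> mN.
have lt (t : n.-tuple 'Z_p) : (code (rev t) < P ^ n)%N.
  by have := ltn_code (rev t); rewrite size_rev size_tuple.
pose f (t : n.-tuple 'Z_p) := Ordinal (lt t).
have f_inj : injective f.
  move=> t t' /(congr1 val) /= e; apply: val_inj; apply: (can_inj revK).
  by apply: code_inj => //; rewrite !size_rev !size_tuple.
have f_bij : bijective f.
  by apply: inj_card_bij f_inj _; rewrite card_tuple !card_ord.
rewrite -[RHS](card_ord_lt mN) -[RHS](on_card_preimset (f := f)) ?cardsE; last exact: onW_bij.
by apply: eq_card => t; rewrite !inE.
Qed.

Lemma card_prefix (Q : pred word) S m :
  (#|[pred t : S.-tuple 'Z_p | Q t]| * P ^ m <=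
   #|[pred t : (S + m).-tuple 'Z_p | Q (take S t)]|)%N.
Proof.
pose X := ({t : S.-tuple 'Z_p | Q t} * m.-tuple 'Z_p)%type.
pose f (x : X) : (S + m).-tuple 'Z_p := cat_tuple (val x.1) x.2.
have f_inj : injective f.
  move=> [[a Qa] b] [[a' Qa'] b'] /(congr1 val)/= /eqP.
  rewrite eqseq_cat ?size_tuple// => /andP[/eqP aa /eqP bb].
  by congr (_, _); apply: val_inj => //=; apply: val_inj.
have <- : #|{: X}| = (#|[pred t : S.-tuple 'Z_p | Q t]| * P ^ m)%N.
  by rewrite card_prod card_sig card_tuple card_ord.
rewrite -(card_imset _ f_inj); apply: subset_leq_card.
apply/fintype.subsetP => _ /imsetP[[[a Qa] b] _ ->].
by rewrite inE /= take_size_cat ?size_tuple.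
Qed.

Lemma card_zero_tail n h : (h <= n)%N ->
  (#|[pred t : n.-tuple 'Z_p | ~~ has (fun d => d != 0%R) (drop h t)]| <= P ^ h)%N.
Proof.
move=> hn.
have sz (t : n.-tuple 'Z_p) : size (take h t) == h by rewrite size_takel ?size_tuple.
pose f t : h.-tuple 'Z_p := Tuple (sz t).
pose A := [pred t : n.-tuple 'Z_p | ~~ has (fun d => d != 0%R) (drop h t)].
have f_inj : {in A &, injective f}.
  move=> t t'; rewrite !inE => zt zt' /(congr1 val) /= e; apply: val_inj.
  rewrite -[val t](cat_take_drop h) -[val t'](cat_take_drop h) /= e.
  have zero (s : word) : ~~ has (fun d => d != 0%R) s -> s = nseq (size s) 0%R.
    rewrite -all_predC => zs; apply/all_pred1P; apply: sub_all zs => d /=.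
    by rewrite negbK.
  by rewrite (zero _ zt) (zero _ zt') !size_drop !size_tuple.
rewrite -(card_in_imset f_inj).
by apply: leq_trans (max_card _) _; rewrite card_tuple card_ord.
Qed.

(** A word with zero second half is determined by its first half, so at most [P ^ n./2] words are
    lost. *)
Lemma card_prefix_tail (Q : pred word) S n : (S <= n)%N ->
  (#|[pred t : S.-tuple 'Z_p | Q t]| * P ^ (n - S) <=
   #|[pred t : n.-tuple 'Z_p | Q (take S t) && has (fun d => d != 0%R) (drop n./2 t)]|
   + P ^ n./2)%N.
Proof.
move=> Sn; have := card_prefix Q S (n - S); rewrite subnKC// => /leq_trans; apply.
have hn : (n./2 <= n)%N by lia.
apply: leq_trans (leq_add (leqnn _) (card_zero_tail hn)).
rewrite -!sum1_card (bigID (fun t : n.-tuple 'Z_p => has (fun d => d != 0%R) (drop n./2 t)))/=.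
rewrite leq_add2l; apply: (@leq_trans #|[pred t : n.-tuple 'Z_p |
  Q (take S t) && ~~ has (fun d => d != 0%R) (drop n./2 t)]|).
  by rewrite -sum1_card.
rewrite sum1_card; apply: subset_leq_card; apply/fintype.subsetP => t; by rewrite !inE => /andP[].
Qed.

End Counting.

(** * Growth of the number of free labels *)

Section Spread.
Variables (R : realType) (p : nat).
Local Notation P := (Zp_trunc p).+2.
Local Notation word := (seq 'Z_p).
Local Notation order n := ((Gamma_order p n)%:R : R).

(* The words u, read as P-adic expansions, whose interval lies in [0, l]. *)
Definition below (l : R) : pred word :=
  fun u => (code (rev u)).+1%:R <= l * (P ^ size u)%:R.

Lemma below_rcons l (u : word) x : below l u -> below l (rcons u x).
Proof.
rewrite /below rev_rcons size_rcons expnSr natrM mulrA => ul.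
apply: le_trans (ler_wpM2r (ler0n _ P) ul).
rewrite -natrM ler_nat /= (mulSn (code _)) -addSn (mulnC _ P) leq_add2r.
exact: (ltn_ord x).
Qed.

Lemma card_below (l : R) n : 0 <= l <= 1 ->
  #|[pred t : n.-tuple 'Z_p | below l t]| = Num.truncn (l * (P ^ n)%:R).
Proof.
move=> /andP[l0 l1].
have lP0 : 0 <= l * (P ^ n)%:R by rewrite mulr_ge0.
rewrite -[RHS](@card_code_lt p n); last first.
  rewrite -(ler_nat R); apply: (@le_trans _ _ (l * (P ^ n)%:R)); first by rewrite truncn_le.
  by rewrite ler_piMl.
apply: eq_card => t; rewrite !inE /below size_tuple.
by rewrite -truncn_ge_nat.
Qed.

Lemma order_expn n : order n = P%:R ^+ (\sum_(i < n) P ^ i)%N.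
Proof. by rewrite card_Gamma_order card_ord natrX. Qed.

Lemma order_powR n (s : R) : order n `^ s = P%:R `^ ((\sum_(i < n) P ^ i)%:R * s).
Proof. by rewrite order_expn -powR_mulrn ?ler0n// -powRrM. Qed.

Lemma branchingE (F : nat -> pred word) n :
  (branching F n)%:R = P%:R `^ (\sum_(i < n) free_count F i)%:R :> R.
Proof. by rewrite /branching natrX powR_mulrn. Qed.

Lemma branching_below (l : R) n : 0 <= l <= 1 ->
  (branching (fun=> below l) n)%:R <= order n `^ l.
Proof.
move=> l01; rewrite branchingE order_powR; apply: ler_powR; first by rewrite ler1n.
rewrite !natr_sum mulr_suml; apply: ler_sum => i _.
rewrite /free_count card_below// mulrC truncn_le mulr_ge0//.
by case/andP: l01.
Qed.

(** Declaring no word free on levels below [n0] lets the prescription property hold on every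
    level. *)
Definition free_words (l : R) S n0 n : pred word := fun u =>
  [&& (n0 <= n)%N, below l (take S u) & has (fun d => d != 0) (drop n./2 u)].

(** [S] comes before [n0] because the threshold from [spread_free] depends on [S]. *)
Lemma branching_free_words (l s : R) : 0 <= l <= 1 -> 0 < s < l ->
  exists S, forall n0, exists n1, forall n, (n1 <= n)%N ->
    order n `^ s <= (branching (free_words l S n0) n)%:R.
Proof.
move=> l01 /andP[s0 sl].
have P_gt0 : 0 < P%:R :> R by rewrite ltr0n.
(* [S] makes [l * P ^ S] exceed [s * P ^ S] by at least 2. Rounding down costs at most 1; half of
   the remaining unit pays for zero tails, the other half becomes the surplus [eta]. *)
pose S := (Num.truncn (2 / (l - s))).+1; exists S => n0.
have PS0 : 0 < (P ^ S)%:R :> R by rewrite ltr0n expn_gt0.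
have sl0 : 0 < l - s by rewrite subr_gt0.
have PS : 2 <= (l - s) * (P ^ S)%:R.
  rewrite mulrC -ler_pdivrMr//; apply/ltW/(lt_trans (truncnS_gt _)).
  by rewrite ltr_nat ltn_expl.
pose q := Num.truncn (l * (P ^ S)%:R).
have qS : s * (P ^ S)%:R + 1 <= q%:R.
  have := truncnS_gt (l * (P ^ S)%:R); rewrite -/q -natr1 => ql.
  by move: PS ql; rewrite mulrBl; lra.
pose eta : R := (2 * (P ^ S)%:R)^-1.
have eta0 : 0 < eta by rewrite invr_gt0 mulr_gt0.
(* From [2 * S + 2] on, [P ^ i./2] is at most half of [P ^ (i - S)]. *)
pose n2 := maxn n0 (2 * S + 2).
pose gamma n := \sum_(i < n) P%:R ^+ i : R.
have gammaE n : (\sum_(i < n) P ^ i)%:R = gamma n.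
  by rewrite natr_sum; apply: eq_bigr => i _; rewrite natrX.
have level i : (n2 <= i)%N ->
    (s + eta) * P%:R ^+ i <= (free_count (free_words l S n0) i)%:R.
  rewrite geq_max => /andP[n0i Si].
  have Si' : (S <= i)%N by lia.
  have := @card_prefix_tail p (below l) S i Si'.
  rewrite card_below// -/q.
  have -> : #|[pred t : i.-tuple 'Z_p | below l (take S t) && has (fun d => d != 0) (drop i./2 t)]|
      = free_count (free_words l S n0) i.
    by apply: eq_card => t; rewrite !inE /free_words n0i.
  move: (free_count _ _) => e.
  rewrite -(ler_nat R) natrD natrM !natrX => qe.
  have half : 2 * (P%:R ^+ S * P%:R ^+ i./2) <= P%:R ^+ i :> R.
    apply: (@le_trans _ _ (P%:R ^+ (S + i./2).+1)).
      by rewrite exprS exprD ler_wpM2r ?mulr_ge0 ?exprn_ge0 ?ler_nat.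
    by rewrite ler_weXn2l ?ler1n//; lia.
  have Pi : P%:R ^+ i = P%:R ^+ S * P%:R ^+ (i - S) :> R by rewrite -exprD subnKC.
  have PSe : P%:R ^+ i * (2 * s * P%:R ^+ S + 1) <= 2 * P%:R ^+ S * e%:R.
    move: qS; rewrite natrX => qS.
    have : P%:R ^+ i * (2 * s * P%:R ^+ S + 1) <= P%:R ^+ i * (2 * q%:R - 1) :> R.
      by rewrite ler_wpM2l ?exprn_ge0//; lra.
    move=> /le_trans; apply.
    have : 2 * P%:R ^+ S * (q%:R * P%:R ^+ (i - S)) <= 2 * P%:R ^+ S * (e%:R + P%:R ^+ i./2) :> R.
      by rewrite ler_wpM2l// mulr_ge0// exprn_ge0.
    rewrite mulrBr mulr1 {1}Pi; lra.
  have PSgt0 : 0 < 2 * P%:R ^+ S :> R by rewrite mulr_gt0// exprn_gt0.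
  rewrite -(ler_pM2l PSgt0); apply: le_trans PSe.
  have etaE : 2 * P%:R ^+ S * eta = 1 by rewrite /eta natrX mulfV// gt_eqF.
  rewrite mulrA mulrDr etaE mulrC; lra.
have total n : (n2 <= n)%N ->
    (s + eta) * gamma n <=
    (\sum_(i < n) free_count (free_words l S n0) i)%:R + (s + eta) * gamma n2.
  move=> nn; rewrite /gamma (big_ord_widen n (fun i => P%:R ^+ i : R) nn).
  rewrite natr_sum !mulr_sumr [X in _ <= _ + X]big_mkcond -big_split/=.
  apply: ler_sum => i _; case: ltnP => [_|ni]; last by rewrite addr0 level.
  by rewrite lerDr.
(* From [n3] on, the surplus [eta * gamma n] outweighs what the levels below [n2] may lack. *)
pose n3 := (Num.truncn ((s + eta) * gamma n2 / eta)).+1.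
exists (maxn n2 n3) => n; rewrite geq_max => /andP[n2n n3n].
rewrite branchingE order_powR; apply: ler_powR; first by rewrite ler1n.
rewrite gammaE.
have n_gamma : n%:R <= gamma n.
  rewrite -gammaE ler_nat -[leqLHS](card_ord n) -sum1_card.
  by apply: leq_sum => i _; rewrite expn_gt0.
have : (s + eta) * gamma n2 <= eta * gamma n.
  rewrite -ler_pdivrMl// [leLHS]mulrC; apply: le_trans n_gamma.
  by apply: le_trans (ltW (truncnS_gt _)) _; rewrite ler_nat.
have := total n n2n; lra.
Qed.

End Spread.

Theorem theorem2 (R : realType) (p : nat) (p_prime : prime p)
    (lambda : R) (lambda01 : 0 <= lambda <= 1) :
  exists G : set (Gamma p),
    (exists a b c : Gamma p, G = generated [set a; b; c]) /\
    hausdorff_dim (closure G) = lambda%:E.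
Proof.
pose Omega : pred (seq 'Z_p) := below lambda.
have Omega_rcons (u : seq 'Z_p) x : Omega u -> Omega (rcons u x) by exact: below_rcons.
exists (spread Omega); split.
  by exists (shifter Omega), (mover Omega), (marker Omega).
apply: hausdorff_dimP => [s s0 ls|s /andP[s0 sl]|]; last by case/andP: lambda01.
- apply: (@hausdorff_upper R p Omega _ s lambda) => //; last first.
    by move=> n; exact: branching_below.
  move=> x /closureP xG u Ou.
  have [g /(spread_supported Omega_rcons) gO xg] := xG (size u).+1.
  by rewrite xg// gO.
- pose s' := (s + lambda) / 2.
  have [ss' s'l] : s < s' /\ s' < lambda by rewrite /s'; split; lra.
  have s'0 : 0 < s' := le_lt_trans s0 ss'.
  have s'l0 : 0 < s' < lambda by rewrite s'0.
  have [S SP] := branching_free_words p lambda01 s'l0.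
  have [n0 n0P] := spread_free Omega S.
  have free n g (phi : seq 'Z_p -> 'Z_p) : spread Omega g -> exists2 g', spread Omega g' &
      agree n g' g /\ (forall u, size u = n -> free_words lambda S n0 n u -> g' u = phi u).
    move=> Gg; have [n0n|nn0] := leqP n0 n.
      have [g' Gg' [g'g g'phi]] := n0P n n0n g phi Gg; exists g' => //.
      by split=> // u un /and3P[_ uS ut]; apply: g'phi => //; apply/andP.
    (* Below level [n0] no word is free, so [g] itself serves. *)
    exists g => //; split=> // u un.
    by rewrite /free_words leqNgt nn0.
  apply: hausdorff_lower free _ s'0 (SP n0).
    by exists 1%g; have [] := spread_subgroup Omega.
  by rewrite s0 ltW.
Qed.
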